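(* Let $\pi_2$ be a generator of $\mathrm{LT}[\pi^2]$, let $\alpha\in\mathbf{C}$ satisfy $\alpha^{q^2(q+1)}=\pi_2$, and let $\sigma\in I_F$ be an element fixing $\pi_2$. Write $\sigma(\alpha)=\zeta\alpha$ with $\zeta\in\mu_{q^2(q+1)}$. For every $\eta\in\mathbb{F}_q^\times$, $\sigma$ acts on the connected component $\overline{\mathbf{Y}}^{\pi_2}_{3,1,c,\eta}$ of the reduction of $\mathbf{Y}^{\pi_2}_{3,1,c}$, given by $-X^qY^{q^2}+XY^{q^3}=1$, as $$\sigma:\overline{\mathbf{Y}}^{\pi_2}_{3,1,c,\eta}\longrightarrow\overline{\mathbf{Y}}^{\pi_2}_{3,1,c,\eta};\quad (X,Y)\mapsto(\zeta^{q}X,\zeta^{-1}Y).$$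
   Context: $F$ is a non-archimedean local field of equal characteristic $p>0$ with residue field $\mathbb{F}_q$ and uniformizer $\pi$; $\mathbf{C}$ is the completion of an algebraic closure of $F$, $v$ the valuation on $\mathbf{C}$ with $v(\pi)=1$. All spaces are rigid analytic curves considered over $\mathbf{C}$. $\mu_n$ denotes the group of $n$-th roots of unity. For $u\in\mathbf{C}$ with $v(u)>0$ put $[\pi]_u(X)=X^{q^2}+uX^q+\pi X$ and $[\pi^2]_u=[\pi]_u\circ[\pi]_u$. Put $[\pi]_{\mathrm{LT}}(X)=\pi X-X^q$; a generator of $\mathrm{LT}[\pi^2]$ is an element $\pi_2\in\mathbf{C}$ with $[\pi]_{\mathrm{LT}}([\pi]_{\mathrm{LT}}(\pi_2))=0$ and $[\pi]_{\mathrm{LT}}(\pi_2)\neq 0$; then $v(\pi_2)=\frac{1}{q(q-1)}$. For $X_2,Y_2$ with $[\pi^2]_u(X_2)=[\pi^2]_u(Y_2)=0$ write $X_1=[\pi]_u(X_2)$, $Y_1=[\pi]_u(Y_2)$ and $$\mu_2(X_2,Y_2)=X_1Y_2^q-X_1^qY_2-X_2^qY_1+X_2Y_1^q .$$ $\mathcal{X}^{\pi_2}(\pi^2)$ is the rigid analytic curve with $\mathbf{C}$-points $\{(u,X_2,Y_2): v(u)>0,\ [\pi^2]_u(X_2)=[\pi^2]_u(Y_2)=0,\ \mu_2(X_2,Y_2)=\pi_2\}$. $\mathbf{Y}^{\pi_2}_{3,1,c}$ is the subspace of $\mathcal{X}^{\pi_2}(\pi^2)$ defined by $v(u)=\frac1{q+1}$,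 $v(X_1)=v(Y_1)=\frac{1}{q(q^2-1)}$, $v(X_2)=v(Y_2)=\frac{1}{q^3(q^2-1)}$. The reduction of a reduced affinoid over $\mathbf{C}$ is $\mathrm{Spec}$ of the ring of power-bounded functions modulo the topologically nilpotent functions. The reduction of $\mathbf{Y}^{\pi_2}_{3,1,c}$ has $q-1$ connected components $\overline{\mathbf{Y}}^{\pi_2}_{3,1,c,\eta}$, $\eta\in\mathbb{F}_q^\times$, where $\eta$ is the reduction of $X_2/Y_2$ on the component. Coordinates on each component: with $x=X_2/\alpha$, $y=Y_2/\alpha$, $t=1/y$, $z=(x^qy-xy^q)/\alpha^{q^2-1}$, the coordinates $(X,Y)$ are the reductions of $X=-zt^q$, $Y=1/t$, and the component is given by $-X^qY^{q^2}+XY^{q^3}=1$. Inertia action: $I_F=\mathrm{Aut}_{\rm cont}(\mathbf{C}/F^{\rm ur})$ acts on the reduction by $\overline{P}\mapsto\overline{P^{\sigma}}$ for points $P$ of the affinoid. Convention: in terms of coordinates, $\sigma$ acts on functions by acting on coefficients, so $u,X_i,Y_i$ are fixed and e.g. $(X_2/\alpha)^\sigma=X_2/\sigma(\alpha)$ (equivalently $P^\sigma=\sigma^{-1}(P)$). Roots of unity are identified with their images in the residue field. *)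

(* Defs.v *)
From HB Require Import structures.
From mathcomp Require Import all_boot all_order all_algebra.
From mathcomp Require Import finmap ring lra.
From mathcomp Require Import all_classical all_reals all_analysis.

Set Implicit Arguments.
Unset Strict Implicit.
Unset Printing Implicit Defensive.

Import Order.TTheory GRing.Theory Num.Theory.

Local Open Scope classical_set_scope.
Local Open Scope ring_scope.

Section Valuation.
Variables (R : realType) (C : fieldType) (v : C -> \bar R).

Definition is_valuation :=
  [/\ forall x, v x = +oo%E <-> x = 0,
      forall x y, v (x * y) = (v x + v y)%E &
      forall x y, (Order.min (v x) (v y) <= v (x + y))%E].

Definition v_cauchy (s : nat -> C) := forall M : R, exists N : nat,
  forall m n, (N <= m)%N -> (N <= n)%N -> (M%:E <= v (s m - s n)%R)%E.

Definition v_cvg (s : nat -> C) (l : C) := forall M : R, exists N : nat,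
  forall n, (N <= n)%N -> (M%:E <= v (l - s n)%R)%E.

Definition v_complete (K : set C) := forall s : nat -> C,
  (forall n, K (s n)) -> v_cauchy s -> exists2 l, K l & v_cvg s l.

Definition v_continuous (f : C -> C) := forall (x : C) (M : R), exists N : R,
  forall y, (N%:E <= v (x - y)%R)%E -> (M%:E <= v (f x - f y)%R)%E.

(* The residue field of the subfield K has exactly n elements: r is a system  *)
(* of representatives of O_K modulo the maximal ideal.                        *)
Definition residue_card (K : set C) (n : nat) := exists r : 'I_n -> C,
  (forall i, K (r i) /\ (0 <= v (r i))%E) /\
  (forall x, K x -> (0 <= v x)%E -> exists! i, (0 < v (x - r i)%R)%E).

End Valuation.

Section BaseFields.
Variables (R : realType) (F : fieldType) (C : fieldType).
Variables (emb : {rmorphism F -> C}) (v : C -> \bar R).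

Definition equal_char_local_field (p q : nat) (pi : F) :=
  [/\ p \in [pchar F],
      forall x, x != 0 -> exists n : int, v (emb x) = (n%:~R)%:E,
      v (emb pi) = 1%:E,
      v_complete v (range emb) &
      residue_card v (range emb) q].

(* For an algebraically closed C, the elements of C algebraic over F form an  *)
(* algebraic closure of F.                                                    *)
Definition completed_alg_closure :=
  v_complete v setT /\
  (forall (x : C) (M : R), exists2 y, algebraicOver emb y &
     (M%:E <= v (x - y)%R)%E).

(* K is a finite unramified extension of F inside C: its degree n over F      *)
(* equals the degree of its residue field over the one of F, which has q      *)
(* elements.                                                                  *)
Definition finite_unramified (q : nat) (K : set C) :=
  [/\ range emb `<=` K,
      forall x y, K x -> K y -> [/\ K (x - y), K (x * y) & K x^-1] &
      exists n : nat, exists b : 'I_n -> C,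
        (forall x, K x <-> exists c : 'I_n -> F, x = \sum_i emb (c i) * b i) /\
        (forall c : 'I_n -> F,
           \sum_i emb (c i) * b i = 0 -> forall i, c i = 0) /\
        residue_card v K (q ^ n)].

Definition max_unramified (q : nat) : set C :=
  [set x | exists2 K, finite_unramified q K & K x].

End BaseFields.

(* F a local field of equal characteristic p > 0 with residue field F_q and   *)
(* uniformizer pi; C the completion of an algebraic closure of F; v the       *)
(* valuation on C with v pi = 1.                                              *)
Record local_data (R : realType) := LocalData {
  ld_p : nat;
  ld_q : nat;
  ld_F : fieldType;
  ld_C :> closedFieldType;
  ld_emb : {rmorphism ld_F -> ld_C};
  ld_v : ld_C -> \bar R;
  ld_unif : ld_F;
  ld_valuation : is_valuation ld_v;
  ld_local : equal_char_local_field ld_emb ld_v ld_p ld_q ld_unif;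
  ld_completed : completed_alg_closure ld_emb ld_v }.

Section InertiaDef.
Variables (R : realType) (D : local_data R).

(* I_F = Aut_cont(C / F^ur). *)
Record inertia := Inertia {
  in_fun :> {rmorphism D -> D};
  in_inv : D -> D;
  in_funK : cancel in_fun in_inv;
  in_invK : cancel in_inv in_fun;
  in_cont : v_continuous (@ld_v R D) in_fun;
  in_inv_cont : v_continuous (@ld_v R D) in_inv;
  in_fix : forall x,
    max_unramified (@ld_emb R D) (@ld_v R D) (ld_q D) x -> in_fun x = x }.

End InertiaDef.

Section PrimeSpectrum.
Variable A : comPzRingType.

Definition is_prime_ideal (I : set A) :=
  [/\ I 0, forall a b, I a -> I b -> I (a + b), forall a b, I b -> I (a * b),
      ~ I 1 & forall a b, I (a * b) -> I a \/ I b].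

Record spec := Spec { spec_ideal :> set A; spec_prime : is_prime_ideal spec_ideal }.

HB.instance Definition _ := gen_eqMixin spec.
HB.instance Definition _ := gen_choiceMixin spec.

Lemma spec_eq (p1 p2 : spec) : (p1 : set A) = p2 -> p1 = p2.
Proof.
by case: p1 p2 => [I HI] [J HJ] /= IJ; subst J; congr Spec; exact: Prop_irrelevance.
Qed.

Definition zariski_closed (E : set A) : set spec := [set p : spec | E `<=` p].

Definition zariski_open : set_system spec :=
  [set U | exists E, U = ~` zariski_closed E].

Lemma zariski_openT : zariski_open setT.
Proof.
exists setT; apply/seteqP; split => // p _ /(_ 1) p1.
by case: (spec_prime p) => _ _ _ /(_ (p1 I)).
Qed.

Lemma zariski_openI : setI_closed zariski_open.
Proof.
move=> _ _ [E ->] [E' ->].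
exists [set x | exists a b, [/\ E a, E' b & x = a * b]].
rewrite -setCU; congr (~` _); apply/seteqP; split => p.
  case: (spec_prime p) => _ _ pM _ _.
  move=> [] Ep _ [a [b [Ea Eb ->]]]; last exact/pM/Ep.
  by rewrite mulrC; exact/pM/Ep.
move=> EE'p; have [|/existsNP[a /not_implyP[Ea pa]]] := pselect (E `<=` p).
  by left.
right=> b Eb; have : spec_ideal p (a * b) by apply: EE'p; exists a, b.
by case: (spec_prime p) => _ _ _ _ pP /pP [].
Qed.

Lemma zariski_open_bigU (I : Type) (f : I -> set spec) :
  (forall i, zariski_open (f i)) -> zariski_open (\bigcup_i f i).
Proof.
move=> /choice [E fE]; exists (\bigcup_i E i).
apply/seteqP; split => p.
  by move=> [i _]; rewrite fE => Eip Ep; apply: Eip => x Ex; apply: Ep; exists i.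
move=> nEp; apply: contrapT => nU; apply: nEp => x [i _ Ex].
by apply: contrapT => px; apply: nU; exists i => //; rewrite fE => /(_ x Ex).
Qed.

HB.instance Definition _ := isOpenTopological.Build spec
  zariski_openT zariski_openI zariski_open_bigU.

Definition is_connected_component (Z : set spec) :=
  exists p, Z = connected_component setT p.

(* Equality of the restrictions of two functions to the reduced closed        *)
(* subscheme supported on Z.                                                  *)
Definition eq_on (Z : set spec) (a b : A) := forall p, Z p -> spec_ideal p (a - b).

End PrimeSpectrum.

Lemma preimage_prime (A B : comPzRingType) (f : {rmorphism A -> B}) (p : spec B) :
  is_prime_ideal (f @^-1` p).
Proof.
case: (spec_prime p) => p0 pD pM p1 pP; split=> /=; first by rewrite rmorph0.
- by move=> a b pa pb /=; rewrite rmorphD; exact: pD.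
- by move=> a b pb /=; rewrite rmorphM; exact: pM.
- by rewrite rmorph1.
- by move=> a b /=; rewrite rmorphM; exact: pP.
Qed.

Definition spec_map (A B : comPzRingType) (f : {rmorphism A -> B}) (p : spec B) :
  spec A := Spec (preimage_prime f p).

Section ValuationTheory.
Variables (R : realType) (C : fieldType) (v : C -> \bar R).
Hypothesis vP : is_valuation v.

Let vge (M : R) (x : C) := (M%:E <= v x)%E.

Lemma v0 : v 0 = +oo%E. Proof. by case: vP => v0 _ _; apply/v0. Qed.

Lemma vM x y : v (x * y) = (v x + v y)%E. Proof. by case: vP. Qed.

Lemma v_neqy x : x != 0 -> v x != +oo%E.
Proof. by case: vP => v0 _ _; apply: contra => /eqP H; apply/eqP/v0. Qed.

Lemma v1 : v 1 = 0%E.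
Proof.
have := vM 1 1; have := v_neqy (oner_neq0 C); rewrite mulr1.
case E : (v 1) => [r| |]//= _.
  by move=> [] /esym/eqP; rewrite -subr_eq0 addrK => /eqP ->.
move=> _; have := vM 1 0; rewrite mulr0 E v0.
by [].
Qed.

Lemma v_fin x : x != 0 -> exists r : R, v x = r%:E.
Proof.
move=> x0; have := vM x x^-1; rewrite divff// v1; have := v_neqy x0.
by case: (v x) => [r| |]//= _ _; exists r.
Qed.

Lemma v_neqNy x : v x != -oo%E.
Proof.
have [->|/v_fin[r ->]//] := eqVneq x 0; by rewrite v0.
Qed.

Lemma vN x : v (- x) = v x.
Proof.
have vN1 : v (-1) = 0%E.
  have := vM (-1) (-1); rewrite mulrNN mulr1 v1.
  have [r ->] : exists r : R, v (-1) = r%:E by apply: v_fin; rewrite oppr_eq0 oner_eq0.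
  rewrite -EFinD => -[] /esym/eqP.
  by rewrite -mulr2n mulrn_eq0/= => /eqP ->.
by rewrite -mulN1r vM vN1 add0e.
Qed.

Lemma vge0 M : vge M 0. Proof. by rewrite /vge v0 leey. Qed.

Lemma vgeD M x y : vge M x -> vge M y -> vge M (x + y).
Proof.
move=> Mx My; case: vP => _ _ /(_ x y); apply: le_trans.
by rewrite le_min; apply/andP.
Qed.

Lemma vgeN M x : vge M (- x) = vge M x. Proof. by rewrite /vge vN. Qed.

Lemma vgeB M x y : vge M x -> vge M y -> vge M (x - y).
Proof. by move=> ? ?; apply: vgeD; rewrite ?vgeN. Qed.

Lemma vge_sum M (I : Type) (s : seq I) (P : pred I) (f : I -> C) :
  (forall i, P i -> vge M (f i)) -> vge M (\sum_(i <- s | P i) f i).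
Proof. by move=> H; elim/big_ind: _ => //; [exact: vge0|exact: vgeD]. Qed.

Lemma vgeM M N x y : vge M x -> vge N y -> vge (M + N) (x * y).
Proof. by move=> Mx My; rewrite /vge vM EFinD; exact: leeD. Qed.

Lemma vge_le M N x : N <= M -> vge M x -> vge N x.
Proof. by move=> NM; apply: le_trans; rewrite lee_fin. Qed.

Lemma vge_lb x : exists M, vge M x.
Proof.
have [->|/v_fin[r E]] := eqVneq x 0; first by exists 0; exact: vge0.
by exists r; rewrite /vge E.
Qed.

Lemma vX x (r : R) n : v x = r%:E -> v (x ^+ n) = (r *+ n)%:E.
Proof.
move=> E; elim: n => [|n IH]; first by rewrite expr0 v1 mulr0n.
by rewrite exprS vM IH E -EFinD mulrS.
Qed.

Lemma v_exprz x (r : R) (n : int) : v x = r%:E -> v (x ^ n) = (n%:~R * r)%:E.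
Proof.
move=> E; have x0 : x != 0.
  by apply: contra_eqN E => /eqP ->; rewrite v0.
case: n => n; first by rewrite -exprnP (vX _ E) mulr_natl.
rewrite NegzE -exprz_inv -exprnP exprVn.
have xn0 : x ^+ n.+1 != 0 by rewrite expf_neq0.
have := vM (x ^+ n.+1) (x ^+ n.+1)^-1; rewrite divff// v1 (vX _ E).
have [s ->] : exists s : R, v (x ^+ n.+1)^-1 = s%:E by apply: v_fin; rewrite invr_eq0.
rewrite -EFinD => -[] /esym/eqP; rewrite addrC addr_eq0 => /eqP ->.
by rewrite mulrNz mulNr mulr_natl.
Qed.

Lemma v_prod (I : Type) (s : seq I) (f : I -> C) (r : I -> R) :
  (forall i, v (f i) = (r i)%:E) ->
  v (\prod_(i <- s) f i) = (\sum_(i <- s) r i)%:E.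
Proof.
move=> E; elim: s => [|i s IH]; first by rewrite !big_nil v1.
by rewrite !big_cons vM IH E EFinD.
Qed.

Lemma cont_pos (f : {rmorphism C -> C}) x :
  v_continuous v f -> (0 < v x)%E -> (0 < v (f x))%E.
Proof.
move=> fc x_gt0; rewrite ltNge; apply/negP => fx_le0.
have [x0|xn0] := eqVneq x 0.
  by move: fx_le0; rewrite x0 rmorph0 v0.
have [r xr] := v_fin xn0.
have [|s fxs] := @v_fin (f x); first by rewrite fmorph_eq0.
move: x_gt0 fx_le0; rewrite xr fxs lte_fin lee_fin => r0 s0.
have [N HN] := fc 0 1.
pose n := (Num.truncn (`|N| / r)).+1.
have := HN (x ^+ n); rewrite rmorph0 !sub0r !vN rmorphXn (vX _ xr) (vX _ fxs) !lee_fin.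
have Nn : N <= r *+ n.
  rewrite -mulr_natr mulrC -ler_pdivrMr//.
  apply: (le_trans (ler_wpM2r _ (ler_norm N))); first by rewrite invr_ge0 ltW.
  by rewrite ltW// /n truncnS_gt.
move=> /(_ Nn) /(lt_le_trans (ltr01)).
by rewrite ltNge mulrn_wle0.
Qed.

Lemma isometry_le (f : {rmorphism C -> C}) (w : C) x :
  v_continuous v f -> v w = 1%:E -> f w = w -> (v x <= v (f x))%E.
Proof.
move=> fc w1 fw; have w0 : w != 0.
  by apply: contra_eqN w1 => /eqP ->; rewrite v0.
have [->|xn0] := eqVneq x 0; first by rewrite rmorph0.
have [r xr] := v_fin xn0.
have [|s fxs] := @v_fin (f x); first by rewrite fmorph_eq0.
rewrite xr fxs lee_fin leNgt; apply/negP => sr.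
pose n := (Num.truncn ((r - s)^-1)).+1.
have rs : 0 < r - s by rewrite subr_gt0.
have n1 : 1 < (r - s) *+ n.
  rewrite -mulr_natl -ltr_pdivrMr// mul1r.
  by rewrite /n truncnS_gt.
pose m := Num.floor (s *+ n) + 1.
pose y := x ^+ n * w ^ (- m).
have vy t z : v z = t%:E -> v (z ^+ n * w ^ (- m)) = (t *+ n - m%:~R)%:E.
  by move=> zt; rewrite vM (vX _ zt) (v_exprz _ w1) -EFinD mulr1 mulrNz.
have : (0 < v (f y))%E.
  apply: cont_pos => //; rewrite (vy r)// lte_fin subr_gt0 /m intrD.
  have := floor_le_tmp (s *+ n); move: n1; rewrite mulrnBl => n1 fl.
  by rewrite (le_lt_trans (lerD fl (lexx _)))// -ltrBrDl.
rewrite /y rmorphM rmorphXn/= fmorphXz fw (vy s)// lte_fin subr_gt0 /m.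
by rewrite ltNge ltW// floorD1_gt.
Qed.

End ValuationTheory.

Section Summation.
Variables (R : realType) (C : fieldType) (v : C -> \bar R).

(* l is the limit of the finite partial sums of t, along the filter of finite *)
(* subsets of I.                                                              *)
Definition sums_to (I : choiceType) (t : I -> C) (l : C) :=
  forall M : R, exists S : {fset I}, forall T : {fset I},
    (S `<=` T)%fset -> (M%:E <= v (l - \sum_(i <- T) t i)%R)%E.

Hypothesis vP : is_valuation v.
Let vge (M : R) (x : C) := (M%:E <= v x)%E.

Variable I : choiceType.
Implicit Types (t : I -> C) (S T : {fset I}).

Lemma fset_sumD t S T : (S `<=` T)%fset ->
  \sum_(i <- T) t i = \sum_(i <- S) t i + \sum_(i <- (T `\` S)%fset) t i.
Proof.
move=> ST; rewrite [LHS](big_fsetID _ (mem S))/=; congr (_ + _).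
  apply: eq_fbigl => i; rewrite !inE/=.
  by apply/andP/idP => [[]//|iS]; rewrite (fsubsetP ST).
by apply: eq_fbigl => i; rewrite !inE/= andbC.
Qed.

Lemma sums_to_bound t l S (M : R) : sums_to t l ->
  (forall i, i \notin S -> vge M (t i)) ->
  forall T, (S `<=` T)%fset -> vge M (l - \sum_(i <- T) t i).
Proof.
move=> tl tM T ST; have [S' HS'] := tl M.
have := HS' (S' `|` T)%fset (fsubsetUl _ _).
rewrite (@fset_sumD t T)//; last exact: fsubsetUr.
move=> H; rewrite -[X in vge M X](subrK (\sum_(i <- ((S' `|` T) `\` T)%fset) t i)).
apply: (vgeD vP); first by rewrite -addrA -opprD.
rewrite big_seq; apply: (vge_sum vP) => i; rewrite !inE => /andP[iT _].
by apply: tM; apply: contra iT; exact: (fsubsetP ST).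
Qed.

Lemma sums_to_bound0 t l (M : R) : sums_to t l ->
  (forall i, vge M (t i)) -> vge M l.
Proof.
move=> tl tM; have := @sums_to_bound t l fset0 M tl (fun i _ => tM i) fset0 (fsubset_refl _).
by rewrite big_seq_fset0 subr0.
Qed.

Lemma sums_to_ex t : v_complete v setT ->
  (forall M : R, finite_set [set i | ~ vge M (t i)]) -> exists l, sums_to t l.
Proof.
move=> vc tfin.
have /choice[S HS] : forall n : nat, exists S : {fset I},
    forall i, i \notin S -> vge n%:R (t i).
  move=> n; have /finite_fsetP[S SE] := tfin n%:R; exists S => i iS.
  apply: contrapT => ti; have : [set` S] i by rewrite -SE.
  by move=> /= iS'; rewrite iS' in iS.
have HD n T : (S n `<=` T)%fset ->
    vge n%:R (\sum_(i <- T) t i - \sum_(i <- S n) t i).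
  move=> ST; rewrite (fset_sumD t ST) addrAC subrr add0r.
  by rewrite big_seq; apply: (vge_sum vP) => i; rewrite !inE => /andP[/HS].
have HSS m n : vge (minn m n)%:R (\sum_(i <- S m) t i - \sum_(i <- S n) t i).
  have Hm := HD m (S m `|` S n)%fset (fsubsetUl _ _).
  have Hn := HD n (S m `|` S n)%fset (fsubsetUr _ _).
  rewrite -[X in vge _ X](subrKA (\sum_(i <- (S m `|` S n)%fset) t i)).
  apply: (vgeD vP).
    rewrite -opprB (vgeN vP); apply: (vge_le _ Hm).
    by rewrite ler_nat geq_minl.
  by apply: (vge_le _ Hn); rewrite ler_nat geq_minr.
have [||l _ Hl] := vc (fun n => \sum_(i <- S n) t i); first by [].
  move=> M; exists (Num.truncn M).+1 => m n Mm Mn.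
  apply: (vge_le _ (HSS m n)); rewrite (le_trans (ltW (truncnS_gt M)))//.
  by rewrite ler_nat leq_min Mm.
exists l => M; have [N HN] := Hl M; pose n := maxn N (Num.truncn M).+1.
exists (S n) => T ST; rewrite -[X in v X](subrKA (\sum_(i <- S n) t i)).
apply: (vgeD vP); first by apply: HN; exact: leq_maxl.
rewrite -opprB (vgeN vP); apply: (vge_le _ (HD n T ST)).
by rewrite (le_trans (ltW (truncnS_gt M)))// ler_nat leq_maxr.
Qed.

Lemma sums_toB t1 t2 l1 l2 : sums_to t1 l1 -> sums_to t2 l2 ->
  sums_to (fun i => t1 i - t2 i) (l1 - l2).
Proof.
move=> H1 H2 M; have [S1 HS1] := H1 M; have [S2 HS2] := H2 M.
exists (S1 `|` S2)%fset => T; rewrite fsubUset => /andP[T1 T2].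
have -> : l1 - l2 - \sum_(i <- T) (t1 i - t2 i) =
    (l1 - \sum_(i <- T) t1 i) - (l2 - \sum_(i <- T) t2 i).
  by rewrite sumrB !opprB addrACA [RHS]addrACA [- l2 - _]addrC.
by apply: (vgeB vP); [exact: HS1|exact: HS2].
Qed.

Lemma sums_toZ t l a : sums_to t l -> sums_to (fun i => t i * a) (l * a).
Proof.
move=> H M; have [B HB] := vge_lb vP a; have [S HS] := H (M - B).
exists S => T ST; rewrite -mulr_suml -mulrBl -[M](subrK B).
by apply: (vgeM vP) => //; exact: HS.
Qed.

End Summation.

Section Curve.
Variables (R : realType) (D : local_data R).
Notation q := (ld_q D).
Notation v := (@ld_v R D).

Definition unif : D := ld_emb D (ld_unif D).

Definition mul_pi (u X : D) : D := X ^+ (q ^ 2) + u * X ^+ q + unif * X.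

Definition mul_LT (X : D) : D := unif * X - X ^+ q.

Definition is_LT2_generator (pi2 : D) :=
  mul_LT (mul_LT pi2) = 0 /\ mul_LT pi2 <> 0.

Definition mu2 (u X2 Y2 : D) : D :=
  let X1 := mul_pi u X2 in let Y1 := mul_pi u Y2 in
  X1 * Y2 ^+ q - X1 ^+ q * Y2 - X2 ^+ q * Y1 + X2 * Y1 ^+ q.

Definition in_Xcurve (pi2 u X2 Y2 : D) :=
  [/\ (0 < v u)%E, mul_pi u (mul_pi u X2) = 0, mul_pi u (mul_pi u Y2) = 0 &
      mu2 u X2 Y2 = pi2].

Definition val_u : R := (q%:R + 1)^-1.
Definition val_1 : R := (q%:R * (q%:R ^+ 2 - 1))^-1.
Definition val_2 : R := (q%:R ^+ 3 * (q%:R ^+ 2 - 1))^-1.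

Record Y31c (pi2 : D) := Pt {
  pt_u : D;
  pt_X2 : D;
  pt_Y2 : D;
  pt_curve : in_Xcurve pi2 pt_u pt_X2 pt_Y2;
  pt_vu : v pt_u = val_u%:E;
  pt_vX1 : v (mul_pi pt_u pt_X2) = val_1%:E;
  pt_vY1 : v (mul_pi pt_u pt_Y2) = val_1%:E;
  pt_vX2 : v pt_X2 = val_2%:E;
  pt_vY2 : v pt_Y2 = val_2%:E }.

Definition pt_X1 (pi2 : D) (P : Y31c pi2) : D := mul_pi (pt_u P) (pt_X2 P).
Definition pt_Y1 (pi2 : D) (P : Y31c pi2) : D := mul_pi (pt_u P) (pt_Y2 P).

Lemma Y31c_eq (pi2 : D) (P Q : Y31c pi2) :
  pt_u P = pt_u Q -> pt_X2 P = pt_X2 Q -> pt_Y2 P = pt_Y2 Q -> P = Q.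
Proof.
case: P Q => u X Y ? ? ? ? ? ? [u' X' Y' ? ? ? ? ? ?] /= uu' XX' YY'.
subst u' X' Y'; congr Pt; exact: Prop_irrelevance.
Qed.

(* The space is Zariski closed in the polyannulus of the (u, X1, Y1, X2, Y2)  *)
(* whose coordinates have the prescribed valuations; as it is reduced, its    *)
(* rigid analytic functions are the functions on C-points which are           *)
(* restrictions of strictly convergent Laurent series in these coordinates    *)
(* (the elements of the Tate algebra of the polyannulus); two of them agree   *)
(* as soon as they agree on C-points, and boundedness is with respect to the  *)
(* supremum norm.                                                             *)

Definition exponent := {ffun 'I_5 -> int}.

Definition coord_val (i : 'I_5) : R :=
  nth 0 [:: val_u; val_1; val_1; val_2; val_2] i.

Definition weight (nu : exponent) : R := \sum_i (nu i)%:~R * coord_val i.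

Definition strictly_convergent (a : exponent -> D) := forall M : R,
  finite_set [set nu | ~ (M%:E <= v (a nu) + (weight nu)%:E)%E].

Section Functions.
Variable pi2 : D.
Notation Y := (Y31c pi2).

Definition coord (P : Y) (i : 'I_5) : D :=
  nth 0 [:: pt_u P; pt_X1 P; pt_Y1 P; pt_X2 P; pt_Y2 P] i.

Definition monomial (nu : exponent) (P : Y) : D := \prod_i coord P i ^ nu i.

Definition analytic (f : Y -> D) := exists a : exponent -> D,
  strictly_convergent a /\
  forall P, sums_to v (fun nu => a nu * monomial nu P) (f P).

Definition power_bounded (f : Y -> D) := exists M : R,
  forall n P, (M%:E <= v (f P ^+ n))%E.

Definition topologically_nilpotent (f : Y -> D) := forall M : R,
  exists N : nat, forall n, (N <= n)%N -> forall P, (M%:E <= v (f P ^+ n))%E.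

Let vP : is_valuation v := ld_valuation D.
Let vge (M : R) (x : D) := (M%:E <= v x)%E.

Lemma coord_valE P i : v (coord P i) = (coord_val i)%:E.
Proof.
rewrite /coord /coord_val /pt_X1 /pt_Y1; case: P => u X2 Y2 /= *.
by case: i => [[|[|[|[|[|]]]]]].
Qed.

Lemma coord_neq0 P i : coord P i != 0.
Proof. by apply/eqP => P0; have := coord_valE P i; rewrite P0 (v0 vP). Qed.

Lemma v_monomial nu P : v (monomial nu P) = (weight nu)%:E.
Proof.
rewrite /monomial; apply: (v_prod vP) => i.
exact: (v_exprz vP _ (coord_valE P i)).
Qed.

Lemma monomialD nu mu P :
  monomial (nu + mu) P = monomial nu P * monomial mu P.
Proof.
rewrite -big_split/=; apply: eq_bigr => i _.
by rewrite ffunE expfzDr// coord_neq0.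
Qed.

Lemma weightD nu mu : weight (nu + mu) = weight nu + weight mu.
Proof.
by rewrite -big_split/=; apply: eq_bigr => i _; rewrite ffunE intrD mulrDl.
Qed.

Lemma monomial0 P : monomial 0 P = 1.
Proof. by apply: big1 => i _; rewrite ffunE expr0z. Qed.

Lemma weight0 : weight 0 = 0.
Proof. by apply: big1 => i _; rewrite ffunE mul0r. Qed.

Let gge (M : R) (nu : exponent) (x : D) := (M%:E <= v x + (weight nu)%:E)%E.

Lemma ggeE M nu x : gge M nu x = vge (M - weight nu) x.
Proof. by rewrite /gge /vge EFinB leeBlDr. Qed.

Lemma gge_monomial M nu x P : gge M nu x = vge M (x * monomial nu P).
Proof. by rewrite /gge /vge (vM vP) v_monomial. Qed.

Lemma strictly_convergentP a : strictly_convergent a <->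
  forall M, exists S : {fset exponent}, forall nu, nu \notin S -> gge M nu (a nu).
Proof.
split=> aM M.
  have /finite_fsetP[S SE] := aM M; exists S => nu nuS.
  apply: contrapT => anu; have : [set` S] nu by rewrite -SE.
  by move=> /= nuS'; rewrite nuS' in nuS.
have [S HS] := aM M; apply: (@sub_finite_set _ _ [set` S]); last exact: finite_fset.
by move=> nu /= anu; apply: contrapT => /negP nuS; apply: anu; exact: HS.
Qed.

Lemma strictly_convergent_lb a : strictly_convergent a ->
  exists B, forall nu, gge B nu (a nu).
Proof.
move=> /strictly_convergentP /(_ 0)[S HS].
have [B HB] : exists B, forall nu, nu \in (S : seq exponent) -> gge B nu (a nu).
  elim: (S : seq exponent) => [|mu s [B HB]]; first by exists 0.
  have [B' HB'] := vge_lb vP (a mu).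
  exists (Order.min B (B' + weight mu)) => nu; rewrite inE => /predU1P[->|/HB].
    by rewrite ggeE; apply: vge_le HB'; rewrite lerBlDr ge_min lexx orbT.
  by rewrite !ggeE; apply: vge_le; rewrite lerB// ge_min lexx.
exists (Order.min B 0) => nu; have [/HB|/HS] := boolP (nu \in S);
  by rewrite !ggeE; apply: vge_le; rewrite lerB// ge_min lexx ?orbT.
Qed.

Lemma analytic_cst c : analytic (cst c).
Proof.
exists (fun nu => if nu == 0 then c else 0); split.
  apply/strictly_convergentP => M; exists [fset 0]%fset => nu.
  by rewrite inE => /negPf ->; rewrite ggeE; exact: (vge0 vP).
move=> P M; exists [fset 0]%fset => T T0.
rewrite (big_fsetD1 (0 : exponent))/=; last by rewrite -fsub1set.
rewrite eqxx monomial0 mulr1 big_seq big1 ?addr0 ?subrr; first exact: (vge0 vP).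
by move=> i; rewrite !inE => /andP[/negPf ->]; rewrite mul0r.
Qed.

Lemma analyticB f g : analytic f -> analytic g -> analytic (f - g).
Proof.
move=> [a [aC fa]] [b [bC gb]]; exists (fun nu => a nu - b nu); split.
  apply/strictly_convergentP => M.
  have [S HS] := (strictly_convergentP a).1 aC M.
  have [T HT] := (strictly_convergentP b).1 bC M.
  exists (S `|` T)%fset => nu; rewrite inE negb_or => /andP[/HS + /HT].
  by rewrite !ggeE; exact: (vgeB vP).
move=> P; have := sums_toB vP (fa P) (gb P).
by under [X in sums_to v X]eq_fun do rewrite -mulrBl.
Qed.

Lemma analyticM f g : analytic f -> analytic g -> analytic (f * g).
Proof.
move=> [a [aC fa]] [b [bC gb]].
have [Ba HBa] := strictly_convergent_lb aC.
have [Bb HBb] := strictly_convergent_lb bC.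
move: aC bC => /strictly_convergentP aC /strictly_convergentP bC.
have gM M N nu mu x y : gge M mu x -> gge N (nu - mu) y -> gge (M + N) nu (x * y).
  rewrite !ggeE => xM yN; have -> : M + N - weight nu =
    (M - weight mu) + (N - weight (nu - mu)).
    by have := weightD (nu - mu) mu; rewrite subrK => ->; ring.
  exact: (vgeM vP).
have prod_lb M nu mu (Sa Sb : {fset exponent}) :
    (forall i, i \notin Sa -> gge (M - Bb) i (a i)) ->
    (forall i, i \notin Sb -> gge (M - Ba) i (b i)) ->
    mu \notin Sa \/ nu - mu \notin Sb -> gge M nu (a mu * b (nu - mu)).
  move=> HSa HSb [/HSa H|/HSb H].
    by rewrite -[M](subrK Bb); apply: gM H (HBb _).
  by rewrite -[M](subrKC Ba); apply: gM (HBa _) H.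
have /choice[c Hc] : forall nu, exists l,
    sums_to v (fun mu => a mu * b (nu - mu)) l.
  move=> nu; apply: (sums_to_ex vP); first by case: (ld_completed D).
  move=> M; have [S HS] := aC (M + weight nu - Bb).
  apply: (@sub_finite_set _ _ [set` S]); last exact: finite_fset.
  move=> mu /= H; apply: contrapT => /negP/HS muS; apply: H.
  have := gM _ _ nu mu _ _ muS (HBb (nu - mu)).
  by rewrite ggeE subrK addrK.
exists c; split.
  apply/strictly_convergentP => M.
  have [Sa HSa] := aC (M - Bb); have [Sb HSb] := bC (M - Ba).
  exists [fset (x + y)%R | x in Sa, y in Sb]%fset => nu nuS.
  rewrite ggeE; apply: (sums_to_bound0 vP (Hc nu)) => mu.
  rewrite -[X in is_true X]ggeE; apply: (prod_lb _ _ _ Sa Sb) => //.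
  have [muS|] := boolP (mu \in Sa); last by left.
  right; apply: contra nuS => ?; apply/imfset2P; exists mu => //.
  by exists (nu - mu) => //; rewrite subrKC.
move=> P M.
have [Sa HSa] := aC (M - Bb); have [Sb HSb] := bC (M - Ba).
exists [fset (x + y)%R | x in Sa, y in Sb]%fset => U HU.
pose ta nu := a nu * monomial nu P; pose tb nu := b nu * monomial nu P.
have gP : vge Bb (g P).
  by apply: (sums_to_bound0 vP (gb P)) => nu; rewrite -[X in is_true X]gge_monomial.
have tP nu mu : ta mu * tb (nu - mu) = a mu * b (nu - mu) * monomial nu P.
  by rewrite /ta /tb mulrACA -monomialD subrKC.
have cU nu : vge M (c nu * monomial nu P - \sum_(mu <- Sa) ta mu * tb (nu - mu)).
  apply: (sums_to_bound vP (S := Sa) (t := fun mu => ta mu * tb (nu - mu))) => //.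
    by under eq_fun do rewrite tP; apply: (sums_toZ vP).
  move=> mu muSa; rewrite tP -[X in is_true X]gge_monomial.
  by apply: (prod_lb _ _ _ Sa Sb) => //; left.
have bU mu : mu \in Sa -> vge (M - Ba) (g P - \sum_(nu <- U) tb (nu - mu)).
  move=> muSa; pose U' := [fset (nu - mu)%R | nu in U]%fset.
  have -> : \sum_(nu <- U) tb (nu - mu) = \sum_(ka <- U') tb ka.
    by rewrite big_imfset//= => x y _ _ /addIr.
  apply: (sums_to_bound vP (S := Sb) (gb P)).
    by move=> i /HSb; rewrite -[X in _ -> is_true X]gge_monomial.
  apply/fsubsetP => ka kaSb; apply/imfsetP; exists (mu + ka) => /=.
    by apply: (fsubsetP HU); apply/imfset2P; exists mu => //; exists ka.
  by rewrite addrAC subrr add0r.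
rewrite -[X in v X](subrKA (\sum_(mu <- Sa) ta mu * g P)).
apply: (vgeD vP).
  rewrite -mulr_suml -mulrBl -[M](subrK Bb); apply: (vgeM vP) => //.
  apply: (sums_to_bound vP (S := Sa) (fa P)) => // i /HSa.
  by rewrite -[X in _ -> is_true X]gge_monomial.
rewrite -[X in v X](subrKA (\sum_(nu <- U) \sum_(mu <- Sa) ta mu * tb (nu - mu))).
apply: (vgeD vP); last first.
  rewrite -sumrB; apply: (vge_sum vP) => nu _.
  by rewrite -(vgeN vP) opprB; exact: cU.
rewrite exchange_big/= -sumrB big_seq; apply: (vge_sum vP) => mu muSa.
rewrite -mulr_sumr -mulrBr -[M](subrKC Ba); apply: (vgeM vP); last exact: bU.
by rewrite -[X in is_true X]gge_monomial.
Qed.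

End Functions.
End Curve.

Section Reduction.
Variables (R : realType) (D : local_data R) (pi2 : D).
Notation q := (ld_q D).
Notation v := (@ld_v R D).
Notation Y := (Y31c pi2).
Let vP : is_valuation v := ld_valuation D.

Lemma power_boundedP (f : Y -> D) :
  power_bounded f <-> forall P, (0 <= v (f P))%E.
Proof.
split=> [[M HM] P|H]; last first.
  exists 0 => n P; elim: n => [|n IH]; first by rewrite expr0 (v1 vP).
  by rewrite exprS -[0 in X in (X <= _)%E]addr0; apply: (vgeM vP).
have [->|/(v_fin vP)[r fr]] := eqVneq (f P) 0; first by rewrite (v0 vP).
rewrite fr lee_fin leNgt; apply/negP => r0.
pose n := (Num.truncn (M / r)).+1.
have := HM n P; rewrite (vX vP _ fr) lee_fin leNgt => /negP; apply.
by rewrite -mulr_natr mulrC -ltr_ndivrMr// /n truncnS_gt.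
Qed.

Lemma topologically_nilpotentP (f : Y -> D) :
  topologically_nilpotent f <->
  exists e : R, 0 < e /\ forall P, (e%:E <= v (f P))%E.
Proof.
split=> [/(_ 1)[N HN]|[e [e0 He]] M].
  exists (N.+1%:R^-1); split => [|P]; first by rewrite invr_gt0 ltr0n.
  have [->|/(v_fin vP)[r fr]] := eqVneq (f P) 0; first by rewrite (v0 vP) leey.
  have := HN N.+1 (leqnSn N) P; rewrite (vX vP _ fr) fr !lee_fin => H.
  by rewrite -[_^-1]mul1r ler_pdivrMr ?ltr0n// mulr_natr.
exists (Num.truncn (M / e)).+1 => n Mn P.
have [Mr|Mr] := leP M (e *+ n); last first.
  exfalso; move: Mr; apply/negP; rewrite -leNgt -mulr_natr mulrC -ler_pdivrMr//.
  by rewrite (le_trans (ltW (truncnS_gt _)))// ler_nat.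
have [->|/(v_fin vP)[r fr]] := eqVneq (f P) 0.
  case: n Mn {Mr} => // n _; by rewrite expr0n/= (v0 vP) leey.
rewrite (vX vP _ fr) lee_fin (le_trans Mr)// ler_wMn2r//.
by have := He P; rewrite fr lee_fin.
Qed.

Definition pb_analytic : {pred Y -> D} :=
  fun f => `[< analytic f /\ power_bounded f >].

Lemma pb_analytic_subring : subring_closed pb_analytic.
Proof.
split.
- apply/asboolP; split; first exact: analytic_cst.
  by apply/power_boundedP => P; rewrite (v1 vP).
- move=> f g /asboolP[fa /power_boundedP fb] /asboolP[ga /power_boundedP gb].
  apply/asboolP; split; first exact: analyticB.
  by apply/power_boundedP => P; apply: (vgeB vP).
- move=> f g /asboolP[fa /power_boundedP fb] /asboolP[ga /power_boundedP gb].
  apply/asboolP; split; first exact: analyticM.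
  apply/power_boundedP => P; rewrite -[0 in X in (X <= _)%E]addr0.
  exact: (vgeM vP).
Qed.

HB.instance Definition _ := GRing.isSubringClosed.Build (Y -> D) pb_analytic
  pb_analytic_subring.

Record Aint := MkAint { Aint_fun :> Y -> D; _ : Aint_fun \in pb_analytic }.

HB.instance Definition _ := [isSub for Aint_fun].
HB.instance Definition _ := [Choice of Aint by <:].
HB.instance Definition _ := 
  GRing.SubChoice_isSubComPzRing.Build _ _ Aint pb_analytic_subring.

Lemma Aint_ge0 (f : Aint) P : (0 <= v (f P))%E.
Proof. by have /asboolP[_ /power_boundedP] := valP f. Qed.

Definition Anil : {pred Aint} := fun f => `[< topologically_nilpotent f >].

Lemma Anil_zmod : zmod_closed Anil.
Proof.
split.
  apply/asboolP/topologically_nilpotentP; exists 1; split => // P.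
  by rewrite (v0 vP) leey.
move=> f g /asboolP/topologically_nilpotentP[e [e0 He]].
move=> /asboolP/topologically_nilpotentP[e' [e'0 He']].
apply/asboolP/topologically_nilpotentP; exists (Order.min e e').
split=> [|P]; first by rewrite lt_min e0.
by apply: (vgeB vP); [apply: vge_le (He P)|apply: vge_le (He' P)];
  rewrite ge_min lexx ?orbT.
Qed.

Lemma Anil_ideal (f g : Aint) : g \in Anil -> f * g \in Anil.
Proof.
move=> /asboolP/topologically_nilpotentP[e [e0 He]].
apply/asboolP/topologically_nilpotentP; exists e; split => // P.
by rewrite -[e]add0r; apply: (vgeM vP) => //; exact: Aint_ge0.
Qed.

HB.instance Definition _ := GRing.isZmodClosed.Build Aint Anil Anil_zmod.

(* Power-bounded modulo topologically nilpotent functions. The ring structure *)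
(* is built below because {quot _} is a ring only for a proper ideal, which   *)
(* here would require the affinoid to be nonempty.                            *)
Definition Ared := Quotient.quot Anil.

HB.instance Definition _ := GRing.Zmodule.on Ared.

Definition redn (f : Aint) : Ared :=
  (\pi_(Quotient.quot Anil) f)%qT.

Lemma redn_eq (f g : Aint) : redn f = redn g <-> f - g \in Anil.
Proof. by rewrite Quotient.idealrBE; split=> /eqP. Qed.

Lemma redn_surj (a : Ared) : exists f, redn f = a.
Proof. by exists (repr a); rewrite /redn reprK. Qed.

Lemma rednB : {morph redn : f g / f - g}.
Proof. by move=> f g; rewrite /redn !piE. Qed.

Definition Ared_one : Ared := redn 1.
Definition Ared_mul (a b : Ared) : Ared := redn (repr a * repr b).

Lemma redn_mulE (f g : Aint) : Ared_mul (redn f) (redn g) = redn (f * g).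
Proof.
apply/redn_eq.
set f' := repr _; set g' := repr _.
have Hf : f' - f \in Anil by apply/redn_eq; rewrite /redn reprK.
have Hg : g' - g \in Anil by apply/redn_eq; rewrite /redn reprK.
have -> : f' * g' - f * g = f' * (g' - g) + g * (f' - f) by ring.
by rewrite rpredD// Anil_ideal.
Qed.

Lemma Ared_mulA : associative Ared_mul.
Proof.
move=> a b c; have [[f <-] [g <-] [h <-]] := And3 (redn_surj a) (redn_surj b) (redn_surj c).
by rewrite !redn_mulE mulrA.
Qed.

Lemma Ared_mulC : commutative Ared_mul.
Proof.
move=> a b; have [f <-] := redn_surj a; have [g <-] := redn_surj b.
by rewrite !redn_mulE mulrC.
Qed.

Lemma Ared_mul1 : left_id Ared_one Ared_mul.
Proof. by move=> a; have [f <-] := redn_surj a; rewrite redn_mulE mul1r. Qed.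

Lemma rednD : {morph redn : f g / f + g}.
Proof. by move=> f g; rewrite /redn !piE. Qed.

Lemma Ared_mulDl : left_distributive Ared_mul +%R.
Proof.
move=> a b c; have [f <-] := redn_surj a; have [g <-] := redn_surj b.
by have [h <-] := redn_surj c; rewrite -rednD !redn_mulE -rednD mulrDl.
Qed.

HB.instance Definition _ := GRing.Zmodule_isComPzRing.Build Ared
  Ared_mulA Ared_mulC Ared_mul1 Ared_mulDl.

HB.instance Definition _ := GRing.isZmodMorphism.Build Aint Ared redn rednB.

Lemma redn_monoid : monoid_morphism redn.
Proof. by split=> // f g; rewrite -redn_mulE. Qed.

HB.instance Definition _ := GRing.isMonoidMorphism.Build Aint Ared redn redn_monoid.

(* The class of f in Ared; meaningful only for f in pb_analytic (0 otherwise). *)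
Definition rclass (f : Y -> D) : Ared := redn (insubd 0 f).

(* The point of the reduction to which P specializes. *)
Definition spz_ideal (P : Y) : set Ared :=
  [set a | exists2 f : Aint, redn f = a & (0 < v (f P))%E].

Lemma spz_idealE P (f : Aint) : spz_ideal P (redn f) <-> (0 < v (f P))%E.
Proof.
split=> [[g /redn_eq/asboolP/topologically_nilpotentP[e [e0 He]] g0]|f0]; last first.
  by exists f.
have -> : f P = g P - (g - f) P by rewrite /= opprB addrC subrK.
have [->|/(v_fin vP)[r gr]] := eqVneq (g P) 0.
  by rewrite sub0r (vN vP) (lt_le_trans _ (He P)).
have := vgeB vP (M := Order.min r e) (x := g P) (y := (g - f) P).
rewrite gr lee_fin ge_min lexx => /(_ isT) H; apply: lt_le_trans (H _).
  by rewrite lte_fin lt_min e0 andbT -lte_fin -gr.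
by apply: le_trans (He P); rewrite lee_fin ge_min lexx orbT.
Qed.

Lemma spz_prime P : is_prime_ideal (spz_ideal P).
Proof.
split.
- by exists 0; rewrite ?raddf0//= (v0 vP).
- move=> _ _ [f <- f0] [g <- g0]; exists (f + g); rewrite ?raddfD//.
  case: vP => _ _ /(_ (f P) (g P)); apply: lt_le_trans.
  by rewrite lt_min f0.
- move=> a _ [g <- g0]; have [f <-] := redn_surj a; exists (f * g); rewrite ?rmorphM//=.
  rewrite (vM vP); move: (Aint_ge0 f P) g0.
  by case: (v (f P)) (v (g P)) => [r| |] [s| |]//=; rewrite ?lte_fin ?lee_fin; lra.
- by rewrite -(rmorph1 redn) => /spz_idealE; rewrite /= (v1 vP) ltxx.
- move=> a b; have [f <-] := redn_surj a; have [g <-] := redn_surj b.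
  rewrite -rmorphM => /spz_idealE fg0.
  have [f0|] := ltP 0%E (v (f P)); first by left; exists f.
  have [g0|] := ltP 0%E (v (g P)); first by right; exists g.
  move: fg0 (Aint_ge0 f P) (Aint_ge0 g P); rewrite /= (vM vP).
  by case: (v (f P)) (v (g P)) => [r| |] [s| |]//=; rewrite ?lte_fin ?lee_fin; lra.
Qed.

Definition spz (P : Y) : spec Ared := Spec (spz_prime P).

End Reduction.

Section InertiaTheory.
Variables (R : realType) (D : local_data R) (s : inertia D).
Notation q := (ld_q D).
Notation v := (@ld_v R D).
Notation emb := (@ld_emb R D).
Let vP : is_valuation v := ld_valuation D.

HB.instance Definition _ := GRing.isZmodMorphism.Build D D (in_inv s)
  (can2_zmod_morphism (@in_funK _ _ s) (@in_invK _ _ s)).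
HB.instance Definition _ := GRing.isMonoidMorphism.Build D D (in_inv s)
  (can2_monoid_morphism (@in_funK _ _ s) (@in_invK _ _ s)).

Lemma base_unramified x : max_unramified emb v q (emb x).
Proof.
exists (range emb); last by exists x.
split=> //.
  move=> _ _ [a _ <-] [b _ <-]; split; first by exists (a - b); rewrite ?rmorphB.
    by exists (a * b); rewrite ?rmorphM.
  by exists a^-1; rewrite ?fmorphV.
exists 1, (fun=> 1); split; [|split].
- move=> y; split => [[a _ <-]|[c ->]].
    by exists (fun=> a); rewrite big_ord1 mulr1.
  by exists (c ord0); rewrite // big_ord1 mulr1.
- move=> c; rewrite big_ord1 mulr1 => /eqP; rewrite fmorph_eq0 => /eqP c0 i.
  by rewrite ord1.
- by rewrite expn1; case: (ld_local D).
Qed.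

Lemma inertia_emb x : s (emb x) = emb x.
Proof. exact/in_fix/base_unramified. Qed.

Lemma v_unif : v (unif D) = 1%:E.
Proof. by case: (ld_local D). Qed.

Lemma inertia_isometry x : v (s x) = v x.
Proof.
apply/eqP; rewrite eq_le; apply/andP; split.
  rewrite -[X in (_ <= v X)%E](in_funK s).
  apply: (isometry_le vP (f := in_inv s) (s x) _ v_unif) => //=.
    exact: in_inv_cont.
  by apply: (can_inj (in_funK s)); rewrite /= in_invK inertia_emb.
apply: (isometry_le vP (f := s) x _ v_unif); first exact: in_cont.
exact: inertia_emb.
Qed.

Lemma inertia_inv_isometry x : v (in_inv s x) = v x.
Proof. by rewrite -inertia_isometry in_invK. Qed.

Lemma inertia_mul_pi u X : s (mul_pi u X) = mul_pi (s u) (s X).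
Proof. by rewrite !rmorphD !rmorphM !rmorphXn inertia_emb. Qed.

Lemma inertia_inv_mul_pi u X :
  in_inv s (mul_pi u X) = mul_pi (in_inv s u) (in_inv s X).
Proof.
by apply: (can_inj (in_funK s)); rewrite inertia_mul_pi !in_invK.
Qed.

Lemma inertia_inv_mu2 u X Y :
  in_inv s (mu2 u X Y) = mu2 (in_inv s u) (in_inv s X) (in_inv s Y).
Proof.
by rewrite /mu2 !(rmorphB, rmorphD) !rmorphM !rmorphXn/= !inertia_inv_mul_pi.
Qed.

Variable pi2 : D.
Hypothesis hs : s pi2 = pi2.
Notation Y := (Y31c pi2).

Lemma pt_sigma_curve (P : Y) : in_Xcurve pi2
  (in_inv s (pt_u P)) (in_inv s (pt_X2 P)) (in_inv s (pt_Y2 P)).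
Proof.
case: (pt_curve P) => u0 X0 Y0 mu; split; first by rewrite inertia_inv_isometry.
- by rewrite -!inertia_inv_mul_pi X0 rmorph0.
- by rewrite -!inertia_inv_mul_pi Y0 rmorph0.
- by rewrite -inertia_inv_mu2 mu -{1}hs in_funK.
Qed.

(* P ^ sigma = sigma^-1 (P). *)
Definition pt_sigma (P : Y) : Y :=
  Pt (pt_sigma_curve P)
     (etrans (inertia_inv_isometry _) (pt_vu P))
     (etrans (congr1 v (esym (inertia_inv_mul_pi _ _)))
        (etrans (inertia_inv_isometry _) (pt_vX1 P)))
     (etrans (congr1 v (esym (inertia_inv_mul_pi _ _)))
        (etrans (inertia_inv_isometry _) (pt_vY1 P)))
     (etrans (inertia_inv_isometry _) (pt_vX2 P))
     (etrans (inertia_inv_isometry _) (pt_vY2 P)).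

(* The action of sigma on the coefficients of the Laurent series, which fixes *)
(* u, X2 and Y2; see fun_sigma_series.                                        *)
Definition fun_sigma (f : Y -> D) : Y -> D := fun P => s (f (pt_sigma P)).

Lemma monomial_sigma nu P :
  s (monomial nu (pt_sigma P)) = monomial nu P.
Proof.
rewrite /monomial rmorph_prod; apply: eq_bigr => i _ /=.
rewrite fmorphXz; congr (_ ^ _); rewrite /coord /pt_X1 /pt_Y1 /=.
by case: i => [[|[|[|[|[|]]]]]] //= _; rewrite ?inertia_mul_pi ?in_invK.
Qed.

Lemma fun_sigma_series (a : exponent -> D) f :
  (forall P, sums_to v (fun nu => a nu * monomial nu P) (f P)) ->
  forall P, sums_to v (fun nu => s (a nu) * monomial nu P) (fun_sigma f P).
Proof.
move=> fa P M; have [S HS] := fa (pt_sigma P) M; exists S => T /HS.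
rewrite -inertia_isometry rmorphB rmorph_sum/=.
by under eq_bigr do rewrite rmorphM monomial_sigma.
Qed.

Lemma fun_sigma_pb f : f \in @pb_analytic _ _ pi2 -> fun_sigma f \in @pb_analytic _ _ pi2.
Proof.
move=> /asboolP[[a [ac fa]] /power_boundedP fb]; apply/asboolP; split; last first.
  by apply/power_boundedP => P; rewrite inertia_isometry.
exists (fun nu => s (a nu)); split; last exact: fun_sigma_series.
by move=> M; under eq_set do rewrite inertia_isometry.
Qed.

Definition Aint_sigma (f : Aint pi2) : Aint pi2 := MkAint (fun_sigma_pb (valP f)).

Lemma Aint_sigma_additive : zmod_morphism Aint_sigma.
Proof. by move=> f g; apply/val_inj/funext => P; rewrite /= /fun_sigma /= rmorphB. Qed.

Lemma Aint_sigma_multiplicative : monoid_morphism Aint_sigma.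
Proof.
split; first by apply/val_inj/funext => P; rewrite /= /fun_sigma /= rmorph1.
by move=> f g; apply/val_inj/funext => P; rewrite /= /fun_sigma /= rmorphM.
Qed.

HB.instance Definition _ := GRing.isZmodMorphism.Build _ _ Aint_sigma
  Aint_sigma_additive.
HB.instance Definition _ := GRing.isMonoidMorphism.Build _ _ Aint_sigma
  Aint_sigma_multiplicative.

Lemma Aint_sigma_nil f : f \in @Anil _ _ pi2 -> Aint_sigma f \in @Anil _ _ pi2.
Proof.
move=> /asboolP/topologically_nilpotentP[e [e0 He]].
apply/asboolP/topologically_nilpotentP; exists e; split => // P.
by rewrite /= inertia_isometry.
Qed.

Definition Ared_sigma (a : Ared pi2) : Ared pi2 := redn (Aint_sigma (repr a)).

Lemma Ared_sigmaE f : Ared_sigma (redn f) = redn (Aint_sigma f).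
Proof.
apply/redn_eq; rewrite -raddfB; apply: Aint_sigma_nil.
by apply/redn_eq; rewrite /redn reprK.
Qed.

Lemma Ared_sigma_additive : zmod_morphism Ared_sigma.
Proof.
move=> a b; have [f <-] := redn_surj a; have [g <-] := redn_surj b.
by rewrite -raddfB !Ared_sigmaE -raddfB -raddfB.
Qed.

Lemma Ared_sigma_multiplicative : monoid_morphism Ared_sigma.
Proof.
split; first by rewrite -(rmorph1 (@redn _ _ pi2)) Ared_sigmaE !rmorph1.
move=> a b; have [f <-] := redn_surj a; have [g <-] := redn_surj b.
by rewrite -rmorphM !Ared_sigmaE -rmorphM -rmorphM.
Qed.

HB.instance Definition _ := GRing.isZmodMorphism.Build _ _ Ared_sigma
  Ared_sigma_additive.
HB.instance Definition _ := GRing.isMonoidMorphism.Build _ _ Ared_sigma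
  Ared_sigma_multiplicative.

Definition red_sigma : spec (Ared pi2) -> spec (Ared pi2) := spec_map Ared_sigma.

(* sigma maps the reduction of P to the reduction of P ^ sigma. *)
Lemma red_sigma_spz P : red_sigma (spz P) = spz (pt_sigma P).
Proof.
apply: spec_eq; apply/seteqP; split=> a; have [f <-] := redn_surj a => /=.
  by rewrite Ared_sigmaE => /spz_idealE H; apply/spz_idealE; rewrite /= inertia_isometry in H.
by move=> /spz_idealE H; rewrite Ared_sigmaE; apply/spz_idealE; rewrite /= inertia_isometry.
Qed.

End InertiaTheory.

Section Components.
Variables (R : realType) (D : local_data R) (pi2 alpha : D).
Notation q := (ld_q D).
Notation v := (@ld_v R D).
Notation Y := (Y31c pi2).
Let vP : is_valuation v := ld_valuation D.

Definition ratio (P : Y) : D := pt_X2 P / pt_Y2 P.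

Lemma ratio_pb : ratio \in @pb_analytic _ _ pi2.
Proof.
pose nu : exponent := [ffun i : 'I_5 => nth 0 [:: 0; 0; 0; 1; -1 : int] i].
have E P : ratio P = monomial nu P.
  by rewrite /monomial !big_ord_recl big_ord0 !ffunE /= !expr0z !mul1r mulr1.
apply/asboolP; split; last first.
  apply/power_boundedP => P; rewrite E v_monomial /weight.
  rewrite !big_ord_recl big_ord0 !ffunE /= /coord_val /=.
  by rewrite !mul0r !add0r addr0 mul1r mulN1r subrr.
exists (fun mu => if mu == nu then 1 else 0); split.
  apply/strictly_convergentP => M; exists [fset nu]%fset => mu.
  by rewrite inE => /negPf ->; rewrite (v0 vP) leey.
move=> P M; exists [fset nu]%fset => T T0.
rewrite (big_fsetD1 nu)/=; last by rewrite -fsub1set.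
rewrite eqxx mul1r E big_seq big1 ?addr0 ?subrr; first exact: (vge0 vP).
by move=> i; rewrite !inE => /andP[/negPf ->]; rewrite mul0r.
Qed.

(* Z is the connected component of the reduction on which X2 / Y2 reduces to  *)
(* eta. As F has equal characteristic, F_q is the set of the x in C with      *)
(* x ^ q = x, and eta stands for its image in the residue field.              *)
Definition is_component (eta : D) (Z : set (spec (Ared pi2))) :=
  let P Z' := is_connected_component Z' /\ eq_on Z' (rclass ratio) (rclass (cst eta)) in
  P Z /\ forall Z', P Z' -> Z' = Z.

Definition co_x (P : Y) : D := pt_X2 P / alpha.
Definition co_y (P : Y) : D := pt_Y2 P / alpha.
Definition co_t (P : Y) : D := 1 / co_y P.
Definition co_z (P : Y) : D :=
  (co_x P ^+ q * co_y P - co_x P * co_y P ^+ q) / alpha ^+ (q ^ 2 - 1).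
Definition co_X (P : Y) : D := - co_z P * co_t P ^+ q.
Definition co_Y (P : Y) : D := 1 / co_t P.

(* The point p has coordinates (X, Y) = (a, b), for a and b in the residue    *)
(* field of C given by representatives in its valuation ring.                 *)
Definition has_coords (p : spec (Ared pi2)) (a b : D) :=
  spec_ideal p (rclass co_X - rclass (cst a)) /\
  spec_ideal p (rclass co_Y - rclass (cst b)).

End Components.

(* Main.v *)
Require Import Defs.
From HB Require Import structures.
From mathcomp Require Import all_boot all_order all_algebra all_fingroup.
From mathcomp Require Import cyclic pgroup fieldext.
From mathcomp Require Import finmap ring lra.
From mathcomp Require Import all_classical all_reals all_analysis.

Set Implicit Arguments.
Unset Strict Implicit.
Unset Printing Implicit Defensive.

Import Order.TTheory GRing.Theory Num.Theory.

Local Open Scope classical_set_scope.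
Local Open Scope ring_scope.

(** Why the theorem holds.

    The action.  On functions, sigma replaces alpha by zeta * alpha and fixes
    X2 and Y2.  Hence x and y are divided by zeta, and z by
    zeta ^ (q * (q + 1)).  In characteristic p the relation
    zeta ^ (q ^ 2 * (q + 1)) = 1 gives zeta ^ (q + 1) = 1 (zeta_order), because
    q is a power of p.  So z is fixed, and X = - z / y ^ q and Y = y are
    multiplied by zeta ^ q and zeta ^ -1: these are identities of functions on
    the affinoid (co_X_sigma, co_Y_sigma).

    The equation.  Put d = X2 ^ q * Y2 - X2 * Y2 ^ q = alpha ^ (q + q ^ 2) * z.
    Expanding mu2 with X1 = [pi]_u(X2) and Y1 = [pi]_u(Y2) leaves only the
    determinants X2 ^ (q ^ k) * Y2 - X2 * Y2 ^ (q ^ k), which are combinations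
    of conjugates of d with coefficients in Y2 (mu2_moore).  Dividing
    mu2 = pi2 by pi2 = alpha ^ (q ^ 2 + q ^ 3) gives
      z ^ q * (1 - e1) - z * (y ^ (q ^ 3 - q) + e2) - z ^ (q ^ 2) * e3 = 1
    with e1, e2, e3 small (co_moore_equation).  By a Newton polygon argument z
    is integral (newton_integral), so X is power-bounded, and what survives
    modulo topologically nilpotent functions is
    z ^ q - z * y ^ (q ^ 3 - q) = 1, that is - X ^ q Y ^ (q ^ 2) + X Y ^ (q ^ 3) = 1
    (co_equation).

    Points and components.  A point with coordinates (a, b) goes to the point
    with coordinates (zeta ^ q * a, zeta ^ -1 * b) only because sigma acts
    trivially on the residue field of C (inertia_residue).  This is where
    inertia is defined by F^ur: each residue class contains an element w
    algebraic over the finite field of Teichmueller representatives in F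
    (residue_algebraic), and F(w) is a finite unramified extension
    (span_finite_unramified), so sigma fixes w.  The same fact shows that sigma
    fixes the class of eta; as it also fixes X2 / Y2 and acts on the spectrum by
    a homeomorphism, it preserves the component of eta (component_sigma). *)

(** * The valuation ring and its maximal ideal *)

Section ValuationIdeals.
Variables (R : realType) (C : fieldType) (v : C -> \bar R).
Hypothesis vP : is_valuation v.

Lemma vnngD x y : (0 <= v x)%E -> (0 <= v y)%E -> (0 <= v (x + y)%R)%E.
Proof. exact: (vgeD vP (M := 0)). Qed.

Lemma vnngM x y : (0 <= v x)%E -> (0 <= v y)%E -> (0 <= v (x * y)%R)%E.
Proof. by move=> x0 y0; rewrite (vM vP) adde_ge0. Qed.

Lemma vnngX x n : (0 <= v x)%E -> (0 <= v (x ^+ n)%R)%E.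
Proof.
by move=> x0; elim: n => [|n IH]; rewrite ?expr0 ?(v1 vP)// exprS vnngM.
Qed.

Lemma vposD x y : (0 < v x)%E -> (0 < v y)%E -> (0 < v (x + y)%R)%E.
Proof.
move=> x0 y0; case: vP => _ _ /(_ x y); apply: lt_le_trans.
by rewrite lt_min x0.
Qed.

Lemma vposB x y : (0 < v x)%E -> (0 < v y)%E -> (0 < v (x - y)%R)%E.
Proof. by move=> x0 y0; apply: vposD; rewrite ?(vN vP). Qed.

Lemma vposBC x y : (0 < v (x - y)%R)%E -> (0 < v (y - x)%R)%E.
Proof. by rewrite -(vN vP) opprB. Qed.

Lemma vpos_trans y x z :
  (0 < v (x - y)%R)%E -> (0 < v (y - z)%R)%E -> (0 < v (x - z)%R)%E.
Proof. by move=> xy /(vposD xy); rewrite addrA subrK. Qed.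

Lemma vpos_sum (I : Type) (s : seq I) (P : pred I) (f : I -> C) :
  (forall i, P i -> (0 < v (f i))%E) -> (0 < v (\sum_(i <- s | P i) f i)%R)%E.
Proof.
by move=> H; elim/big_ind: _ => //; [rewrite (v0 vP)|exact: vposD].
Qed.

Lemma vnng_sum (I : Type) (s : seq I) (P : pred I) (f : I -> C) :
  (forall i, P i -> (0 <= v (f i))%E) -> (0 <= v (\sum_(i <- s | P i) f i)%R)%E.
Proof. exact: (vge_sum vP (M := 0)). Qed.

Lemma vposM x y : (0 <= v x)%E -> (0 < v y)%E -> (0 < v (x * y)%R)%E.
Proof.
rewrite (vM vP); case: (v x) (v y) => [r| |] [s| |]//=.
by rewrite ?lte_fin ?lee_fin; lra.
Qed.

Lemma vposMl x y : (0 < v x)%E -> (0 <= v y)%E -> (0 < v (x * y)%R)%E.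
Proof. by rewrite mulrC => x0 y0; exact: vposM. Qed.

Lemma vpos_mul x y : (0 <= v x)%E -> (0 <= v y)%E ->
  (0 < v (x * y)%R)%E -> (0 < v x)%E \/ (0 < v y)%E.
Proof.
move=> x0 y0; have [?|x1] := ltP 0%E (v x); first by left.
have [?|y1] := ltP 0%E (v y); first by right.
rewrite (vM vP); have -> : v x = 0%E by apply/le_anti/andP.
by have -> : v y = 0%E; [apply/le_anti/andP|rewrite adde0 ltxx].
Qed.

Lemma vpos_prod (I : eqType) (s : seq I) (f : I -> C) :
  (forall i, i \in s -> (0 <= v (f i))%E) -> (0 < v (\prod_(i <- s) f i)%R)%E ->
  exists2 i, i \in s & (0 < v (f i))%E.
Proof.
elim: s => [_|i s IH f0]; first by rewrite big_nil (v1 vP) ltxx.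
have fs j : j \in s -> (0 <= v (f j))%E by move=> js; rewrite f0// inE js orbT.
rewrite big_cons => /vpos_mul [|||/(IH fs)[j js fj]].
- by rewrite f0// mem_head.
- by rewrite big_seq; elim/big_ind: _ => //; [rewrite (v1 vP)|exact: vnngM].
- by exists i; rewrite ?mem_head.
- by exists j; rewrite // inE js orbT.
Qed.

Lemma vposX x n : (0 < v x)%E -> (0 < v (x ^+ n.+1)%R)%E.
Proof. by move=> x0; rewrite exprS vposMl// vnngX// ltW. Qed.

Lemma vposBM x x' y y' : (0 <= v x)%E -> (0 <= v y')%E ->
  (0 < v (x - x')%R)%E -> (0 < v (y - y')%R)%E ->
  (0 < v (x * y - x' * y')%R)%E.
Proof.
move=> x0 y0 xx yy.
have -> : x * y - x' * y' = x * (y - y') + (x - x') * y' by ring.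
by apply: vposD; [exact: vposM|exact: vposMl].
Qed.

Lemma vnng_congr x y : (0 <= v x)%E -> (0 < v (x - y)%R)%E -> (0 <= v y)%E.
Proof.
move=> x0 xy; rewrite -[y](subKr x); apply: (vgeB vP (M := 0)) => //.
exact: ltW.
Qed.

Lemma vpos_prodB (I : Type) (s : seq I) (P : pred I) (f g : I -> C) :
  (forall i, P i -> (0 <= v (f i))%E) -> (forall i, P i -> (0 < v (f i - g i)%R)%E) ->
  (0 < v (\prod_(i <- s | P i) f i - \prod_(i <- s | P i) g i)%R)%E.
Proof.
move=> f0 fg.
have H : (0 <= v (\prod_(i <- s | P i) f i)%R)%E /\
    (0 < v (\prod_(i <- s | P i) f i - \prod_(i <- s | P i) g i)%R)%E.
  elim/big_rec2: _ => [|i x y Pi [y0 xy]]; first by rewrite subrr (v0 vP) (v1 vP).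
  split; first by rewrite vnngM ?f0.
  by apply: vposBM; rewrite ?f0 ?fg//; exact: vnng_congr xy.
by case: H.
Qed.

Lemma vV x (r : R) : v x = r%:E -> v x^-1 = (- r)%:E.
Proof. by move=> /(v_exprz vP (-1 : int)); rewrite mulN1r. Qed.

Lemma vV_gt0 x : x != 0 -> (0 < v x^-1)%E = (v x < 0)%E.
Proof. by move=> /(v_fin vP) [r E]; rewrite (vV E) E !lte_fin oppr_gt0. Qed.

Lemma v_expr_eq0 x n : x ^+ n.+1 = 1 -> v x = 0%E.
Proof.
move=> x1; have [r xr] : exists r : R, v x = r%:E.
  apply: (v_fin vP); apply: contra_eqN x1 => /eqP ->.
  by rewrite expr0n eq_sym oner_eq0.
have := vX vP n.+1 xr; rewrite x1 (v1 vP) xr => -[] /esym/eqP.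
by rewrite mulrn_eq0 => /eqP ->.
Qed.

End ValuationIdeals.

(** * The residue field of F *)

Section FiniteResidue.
Variables (R : realType) (F : fieldType) (w : F -> \bar R).
Hypothesis wP : is_valuation w.
Variables (q : nat) (r : 'I_q -> F) (cls : F -> 'I_q).
Hypothesis r_nng : forall i, (0 <= w (r i))%E.
Hypothesis cls_congr : forall x, (0 <= w x)%E -> (0 < w (x - r (cls x))%R)%E.
Hypothesis cls_uniq : forall x i, (0 <= w x)%E -> (0 < w (x - r i)%R)%E -> cls x = i.

Lemma cls_eq x y : (0 <= w x)%E -> (0 < w (x - y)%R)%E -> cls x = cls y.
Proof.
move=> x0 xy; have y0 := vnng_congr wP x0 xy; apply: cls_uniq => //.
exact: (vpos_trans wP) xy (cls_congr y0).
Qed.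

Lemma cls_r i : cls (r i) = i.
Proof. by apply: cls_uniq => //; rewrite subrr (v0 wP). Qed.

Lemma cls_eq_congr x y : (0 <= w x)%E -> (0 <= w y)%E -> cls x = cls y ->
  (0 < w (x - y)%R)%E.
Proof.
move=> x0 y0 xy; apply: (vpos_trans wP) (cls_congr x0) _.
by rewrite xy; apply: (vposBC wP); exact: cls_congr.
Qed.

Let shift (i j : 'I_q) := cls (r i + r j).

Let shift_inj i : injective (shift i).
Proof.
move=> j k /cls_eq_congr H; rewrite -[j]cls_r -[k]cls_r; apply: cls_eq => //.
by rewrite -(addrKA (r i)) [r j + r i]addrC H//; apply: (vnngD wP).
Qed.

Let tr i : {perm 'I_q} := perm (@shift_inj i).

Let tr_mul i j : (tr i * tr j)%g = tr (cls (r i + r j)).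
Proof.
apply/permP => k; rewrite permM !permE; have wD := vnngD wP.
apply: cls_eq; first by rewrite wD.
have -> : r j + r (shift i k) - (r (cls (r i + r j)) + r k) =
  (r i + r j - r (cls (r i + r j))) - (r i + r k - r (shift i k)) by ring.
by apply: (vposB wP); apply: cls_congr; exact: wD.
Qed.

Let tr0 : tr (cls 0) = 1%g.
Proof.
apply/permP => k; rewrite permE perm1 -[RHS]cls_r; have w0 := v0 wP.
have c0 : (0 < w (r (cls 0)))%E.
  by rewrite -(vN wP) -sub0r cls_congr ?w0.
by apply: cls_eq; rewrite ?addrK// (vnngD wP).
Qed.

(** The translations of the residue field form a group of order q and
    exponent p, so by Cauchy's theorem p is the only prime divisor of q. *)
Lemma residue_card_pnat p : p \in [pchar F] -> p.-nat q.
Proof.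
move=> pF; have p_pr := pcharf_prime pF.
have q_gt0 : (0 < q)%N by apply: leq_ltn_trans (ltn_ord (cls 0)).
pose G := [set tr i | i : 'I_q]%SET.
have GP : group_set G.
  apply/group_setP; split; first by apply/imsetP; exists (cls 0); rewrite ?tr0.
  move=> _ _ /imsetP[i _ ->] /imsetP[j _ ->]; rewrite tr_mul.
  exact: imset_f.
have tr_inj : injective tr.
  move=> i j /permP /(_ (cls 0)); rewrite !permE => /cls_eq_congr H.
  rewrite -[i]cls_r -[j]cls_r; apply: cls_eq => //.
  by rewrite -(addrKA (r (cls 0))) [r (cls 0) + r j]addrC H// (vnngD wP).
have cardG : #|Group GP| = q by rewrite card_imset// card_ord.
apply/pnatP => // l l_pr; rewrite -{1}cardG => /(Cauchy l_pr)[_ /imsetP[i _ ->] ol].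
have trX n : (tr i ^+ n)%g = tr (cls (r i *+ n)).
  elim: n => [|n IH]; first by rewrite expg0 mulr0n tr0.
  rewrite expgS IH tr_mul; congr tr; apply: cls_eq.
    by apply: (vnngD wP).
  rewrite mulrS opprD addrACA subrr add0r; apply: (vposBC wP); apply: cls_congr.
  rewrite -mulr_natr (vnngM wP)//.
  elim: n {IH} => [|n IH]; first by rewrite (v0 wP).
  by rewrite -natr1 (vnngD wP)// (v1 wP).
have : (tr i ^+ p)%g = 1%g by rewrite trX -mulr_natr (pcharf0 pF) mulr0 tr0.
by move/eqP; rewrite -order_dvdn ol dvdn_prime2.
Qed.

(** Fermat's little theorem in the residue field: multiplication by a unit
    permutes the nonzero residue classes, hence does not change the product of
    their representatives. *)
Lemma residue_fermat x : (0 <= w x)%E -> (0 < w (x ^+ q - x)%R)%E.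
Proof.
move=> x0; have q_gt0 : (0 < q)%N by apply: leq_ltn_trans (ltn_ord (cls 0)).
have [xp|xu] := boolP (0 < w x)%E.
  by rewrite (vposB wP)// -(prednK q_gt0) (vposX wP).
have mul_inj : injective (fun i => cls (x * r i)).
  move=> i j /cls_eq_congr H; rewrite -[i]cls_r -[j]cls_r; apply: cls_eq => //.
  have : (0 < w (x * (r i - r j))%R)%E by rewrite mulrBr H// (vnngM wP).
  move=> /(vpos_mul wP) [//||xp|//]; last by rewrite xp in xu.
  exact: (vgeB wP (M := 0)).
pose P := [pred i | i != cls 0].
have rP i : ~~ P i -> (0 < w (r i))%E.
  by rewrite negbK => /eqP ->; rewrite -(vN wP) -sub0r cls_congr ?(v0 wP).
have Pr i : P i -> ~~ (0 < w (r i))%E.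
  apply: contra => ri; rewrite -[i]cls_r; apply/eqP/esym/cls_eq; rewrite ?(v0 wP)//.
  by rewrite sub0r (vN wP).
have cardP : #|P| = q.-1.
  by rewrite (cardC1 (cls 0)) card_ord.
have xr0 i : (0 <= w (x * r i)%R)%E by exact: (vnngM wP).
have := @vpos_prodB _ _ _ wP _ (index_enum 'I_q) P (fun i => x * r i)
   (fun i => r (cls (x * r i))) (fun i _ => xr0 i) (fun i _ => cls_congr (xr0 i)).
rewrite big_split/= prodr_const cardP.
have PE i : P (cls (x * r i)) = P i.
  have [Pi|nPi] := boolP (P i).
    apply: contraT => /rP H; move/negP: (Pr _ Pi); case.
    have : (0 < w (x * r i)%R)%E.
      by rewrite -[x * r i](subrK (r (cls (x * r i)))) (vposD wP)// cls_congr.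
    by move=> /(vpos_mul wP) [//|//|xp|//]; rewrite xp in xu.
  apply/negbTE; rewrite negbK; apply/eqP/cls_eq; rewrite ?subr0//.
  by apply: (vposM wP) => //; exact: rP.
set Pi := \prod_(i | P i) r i.
have -> : \prod_(i | P i) r (cls (x * r i)) = Pi.
  rewrite /Pi [RHS](reindex_inj mul_inj); apply: eq_bigl => i.
  by rewrite [RHS]PE.
rewrite -[X in _ - X]mul1r -mulrBl => /(vpos_mul wP).
have w1 := v1 wP; have xq0 : (0 <= w (x ^+ q.-1)%R)%E by exact: (vnngX wP).
have Pi0 : (0 <= w Pi)%E /\ ~~ (0 < w Pi)%E.
  rewrite /Pi; elim/big_ind: _; first by rewrite w1 ltxx.
    move=> a b [a0 a1] [b0 b1]; split; first exact: (vnngM wP).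
    by apply/negP => /(vpos_mul wP) [//|//||]; apply/negP.
  by move=> i /Pr.
case: Pi0 => Pi0 Pi1; move=> /(_ _ Pi0) [||H].
- by apply: (vgeB wP (M := 0)); rewrite ?w1.
- have -> : x ^+ q - x = x * (x ^+ q.-1 - 1) by rewrite mulrBr mulr1 -exprS prednK.
  exact: (vposM wP).
- by rewrite H in Pi1.
Qed.

End FiniteResidue.

Section LocalField.
Variables (R : realType) (D : local_data R).
Notation q := (ld_q D).
Notation F := (ld_F D).
Notation emb := (@ld_emb R D).
Notation v := (@ld_v R D).
Let vP : is_valuation v := ld_valuation D.

Definition vF (x : F) : \bar R := v (emb x).

Lemma vF_valuation : is_valuation vF.
Proof.
split=> [x|x y|x y]; rewrite /vF ?rmorphM ?rmorphD; last 2 first.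
- exact: (vM vP).
- by case: vP.
- by case: vP => /(_ (emb x)) -> _ _; rewrite -(rmorph0 emb); split=> [/fmorph_inj|->].
Qed.
Let wP := vF_valuation.

Lemma residue_reps : exists (r : 'I_q -> F) (cls : F -> 'I_q),
  [/\ forall i, (0 <= vF (r i))%E,
      forall x, (0 <= vF x)%E -> (0 < vF (x - r (cls x))%R)%E &
      forall x i, (0 <= vF x)%E -> (0 < vF (x - r i)%R)%E -> cls x = i].
Proof.
have [_ _ _ _ [r [r1 r2]]] := ld_local D.
have /choice[r' r'E] : forall i, exists y, emb y = r i.
  by move=> i; case: (r1 i) => -[y _ <-] _; exists y.
have /choice[cls clsP] : forall x, exists i, (0 <= vF x)%E ->
    (0 < vF (x - r' i)%R)%E /\ forall j, (0 < vF (x - r' j)%R)%E -> i = j.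
  move=> x; have [x0|/negbTE nx] := boolP (0 <= vF x)%E.
    have [i [i1 i2]] := r2 (emb x) (ex_intro2 _ _ x I erefl) x0.
    exists i => _; split=> [|j]; rewrite /vF rmorphB r'E//.
    exact: i2.
  have [|i _] := r2 0 (ex_intro2 _ _ 0 I (rmorph0 _)); first by rewrite (v0 vP).
  by exists i.
exists r', cls; split.
- by move=> i; rewrite /vF r'E; case: (r1 i).
- by move=> x x0; case: (clsP x x0).
- by move=> x i x0; case: (clsP x x0) => _; apply.
Qed.

Lemma char_C : ld_p D \in [pchar D].
Proof. by case: (ld_local D) => pF _ _ _ _; rewrite (fmorph_pchar emb). Qed.

Lemma q_pnat : (ld_p D).-nat q.
Proof.
have [r [cls [r1 r2 r3]]] := residue_reps.
by case: (ld_local D) => pF _ _ _ _; exact: (residue_card_pnat wP r1 r2 r3).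
Qed.

Lemma q_gt1 : (1 < q)%N.
Proof.
have [r [cls [r1 r2 r3]]] := residue_reps.
rewrite ltnNge; apply/negP => q1.
have : cls 0 = cls 1.
  have cls0 x : cls x = 0%N :> nat.
    by apply/eqP; rewrite -leqn0 -ltnS (leq_trans (ltn_ord _) q1).
  by apply/ord_inj; rewrite !cls0.
move=> /(cls_eq_congr wP r2).
by rewrite (v0 wP) (v1 wP) leey lexx sub0r (vN wP) (v1 wP) ltxx => /(_ isT isT).
Qed.

Lemma q_gt0 : (0 < q)%N. Proof. exact: ltnW q_gt1. Qed.

Lemma frobD n (x y : D) : (x + y) ^+ (q ^ n) = x ^+ (q ^ n) + y ^+ (q ^ n).
Proof.
by rewrite exprDn_pchar// pnatX (eq_pnat _ (pcharf_eq char_C)) q_pnat.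
Qed.

Lemma fermat x : (0 <= vF x)%E -> (0 < vF (x ^+ q - x)%R)%E.
Proof.
have [r [cls [r1 r2 r3]]] := residue_reps.
exact: (residue_fermat wP r1 r2 r3).
Qed.

End LocalField.

(** * Teichmueller representatives *)

Section Teichmueller.
Variables (R : realType) (D : local_data R).
Notation q := (ld_q D).
Notation F := (ld_F D).
Notation emb := (@ld_emb R D).
Notation v := (@ld_v R D).
Let vP : is_valuation v := ld_valuation D.
Let wP : is_valuation (@vF R D) := vF_valuation D.

(** The valuation of F is discrete, with value group generated by 1. *)
Lemma vF_gt0 (x : F) : (0 < vF x)%E -> (1%:E <= vF x)%E.
Proof.
have [->|x0] := eqVneq x 0; first by rewrite (v0 wP) leey.
case: (ld_local D) => _ /(_ _ x0)[n nE] _ _ _.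
by rewrite /vF nE lte_fin lee_fin ltr0z ler1z.
Qed.

Lemma frobB n (x y : D) : (x - y) ^+ (q ^ n) = x ^+ (q ^ n) - y ^+ (q ^ n).
Proof. by apply/eqP; rewrite eq_sym subr_eq -frobD subrK. Qed.

Lemma frobB1 (x y : D) : (x - y) ^+ q = x ^+ q - y ^+ q.
Proof. by have := frobB 1 x y; rewrite expn1. Qed.

Lemma fixed_unit (x : D) : x ^+ q = x -> x != 0 -> v x = 0%E.
Proof.
move=> xq x0; have q1 := q_gt1 D.
have xq1 : x ^+ q.-1 = 1.
  by apply: (mulfI x0); rewrite mulr1 -exprS prednK// ltnW.
by apply: (v_expr_eq0 vP (n := q.-2)); rewrite prednK// -ltnS prednK// ltnW.
Qed.

(** The limit of the iterates x ^ (q ^ n), which form a Cauchy sequence by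
    Fermat's little theorem. *)
Lemma teichmueller (x : F) : (0 <= vF x)%E ->
  exists t : F, t ^+ q = t /\ (0 < vF (x - t)%R)%E.
Proof.
move=> x0; have q0 := q_gt0 D.
pose s n : D := emb x ^+ (q ^ n).
have sD m n : (n <= m)%N -> (n.+1%:R%:E <= v (s m - s n)%R)%E.
  move=> /subnKC <-; elim: (m - n)%N => [|k IH].
    by rewrite addn0 subrr (v0 vP) leey.
  rewrite addnS -[s _ in X in (_ <= X)%E](subrK (s (n + k)%N)) -addrA.
  apply: (vgeD vP) => //; set l := (n + k)%N.
  have -> : s l.+1 - s l = (emb (x ^+ q - x)) ^+ (q ^ l).
    by rewrite rmorphB rmorphXn frobB -exprM -expnS.
  have [->|/(v_fin vP)[r rE]] := eqVneq (emb (x ^+ q - x)) 0.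
    by rewrite expr0n expn_eq0 (gtn_eqF q0) (v0 vP) leey.
  have := vF_gt0 (fermat x0); rewrite /vF rE (vX vP _ rE) !lee_fin => r1.
  apply: (@le_trans _ _ (q ^ l)%:R).
    by rewrite ler_nat (leq_ltn_trans (leq_addr k n))// ltn_expl// q_gt1.
  by rewrite -(mulr_natr r) ler_peMl.
have sC : v_cauchy v s.
  move=> M; exists (Num.truncn M) => m n Mm Mn.
  wlog nm : m n Mm Mn / (n <= m)%N => [H|].
    have [|/ltnW mn] := leqP n m; first exact: H.
    by rewrite -(vN vP) opprB; exact: H.
  apply: le_trans (sD _ _ nm); rewrite lee_fin.
  by rewrite ltW// (lt_le_trans (truncnS_gt _))// ler_nat.
have [|_ [t _ <-] tl] := (let: And5 _ _ _ c _ := ld_local D in c) s _ sC.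
  by move=> n; exists (x ^+ (q ^ n)); rewrite ?rmorphXn.
exists t; split; last first.
  (* t and x are both congruent to a late term of the sequence. *)
  have [N HN] := tl 1; rewrite /vF rmorphB.
  have -> : emb x - emb t = - (s N - s 0%N) - (emb t - s N).
    by rewrite /s expn0 expr1; ring.
  apply: (vposB vP); rewrite ?(vN vP).
    by apply: lt_le_trans (sD _ _ (leq0n N)); rewrite lte_fin.
  by apply: lt_le_trans (HN N (leqnn N)); rewrite lte_fin.
apply: (fmorph_inj emb); rewrite rmorphXn/=.
have H (M : R) : 0 <= M -> (M%:E <= v (emb t ^+ q - emb t)%R)%E.
  move=> M0; have [N HN] := tl M.
  have -> : emb t ^+ q - emb t = (emb t - s N) ^+ q - (emb t - s N.+1).
    by rewrite frobB1 /s -exprM -expnSr; ring.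
  apply: (vgeB vP); last by apply: HN; exact: leqnSn.
  have := HN N (leqnn N).
  have [->|/(v_fin vP)[r rE]] := eqVneq (emb t - s N) 0.
    by rewrite expr0n (gtn_eqF q0).
  rewrite rE (vX vP _ rE) !lee_fin => Mr; apply: (le_trans Mr).
  by rewrite -mulr_natr ler_peMr ?ler1n// (le_trans M0).
apply/eqP; rewrite -subr_eq0; apply: contraT => /(v_fin vP)[r rE].
have := H (`|r| + 1); rewrite rE lee_fin addr_ge0// => /(_ isT).
by rewrite leNgt (le_lt_trans (ler_norm r))// ltrDl.
Qed.

Lemma teichmueller_reps : exists (t : 'I_q -> F) (cls : F -> 'I_q),
  [/\ forall i, t i ^+ q = t i,
      forall x, (0 <= vF x)%E -> (0 < vF (x - t (cls x))%R)%E &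
      forall x i, (0 <= vF x)%E -> (0 < vF (x - t i)%R)%E -> cls x = i].
Proof.
have [r [cls [r0 rcls clsU]]] := residue_reps D.
have /choice[t tP] : forall i, exists t, t ^+ q = t /\ (0 < vF (r i - t)%R)%E.
  by move=> i; exact: teichmueller.
exists t, cls; split=> [i|x x0|x i x0 xt]; first by case: (tP i).
  by apply: (vpos_trans wP) (rcls x x0) _; case: (tP (cls x)).
apply: clsU => //; apply: (vpos_trans wP) xt _.
by apply: (vposBC wP); case: (tP i).
Qed.

Lemma fixed_integral (x : D) : x ^+ q = x -> (0 <= v x)%E.
Proof.
move=> xq; have [->|x0] := eqVneq x 0; first by rewrite (v0 vP).
by rewrite fixed_unit.
Qed.

End Teichmueller.

(** * Finite unramified extensions *)

Section ConstantField.
Variables (R : realType) (D : local_data R).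
Notation q := (ld_q D).
Notation F := (ld_F D).
Notation emb := (@ld_emb R D).
Notation v := (@ld_v R D).
Let vP : is_valuation v := ld_valuation D.

Definition Fq_pred : {pred F} := fun x => x ^+ q == x.

Lemma Fq_pred_divring : divring_closed Fq_pred.
Proof.
split=> [|x y /eqP xq /eqP yq|x y /eqP xq /eqP yq].
- by rewrite unfold_in expr1n.
- rewrite unfold_in -(inj_eq (fmorph_inj emb)) rmorphXn !rmorphB frobB1.
  by rewrite -!rmorphXn xq yq.
- by rewrite unfold_in exprMn exprVn xq yq.
Qed.

HB.instance Definition _ := GRing.isDivringClosed.Build F Fq_pred Fq_pred_divring.

(** The Teichmueller representatives of F: its subfield with q elements, which
    exists because F has equal characteristic. *)
Record Fq := MkFq { Fq_val : F; Fq_valP : Fq_val \in Fq_pred }.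

HB.instance Definition _ := [isSub for Fq_val].
HB.instance Definition _ := [Choice of Fq by <:].
HB.instance Definition _ := [SubChoice_isSubIntegralDomain of Fq by <:].
HB.instance Definition _ := [SubIntegralDomain_isSubField of Fq by <:].


Definition Fq_emb (x : Fq) : D := emb (val x).

HB.instance Definition _ := GRing.RMorphism.copy Fq_emb (emb \o (val : Fq -> F)).

Lemma Fq_emb_unit (x : Fq) : x != 0 -> v (Fq_emb x) = 0%E.
Proof.
move=> x0; apply: fixed_unit; last by rewrite fmorph_eq0.
by rewrite -(rmorphXn emb); congr (emb _); apply/eqP; exact: (valP x).
Qed.

Lemma Fq_emb_nng (x : Fq) : (0 <= v (Fq_emb x))%E.
Proof.
have [->|x0] := eqVneq x 0; first by rewrite rmorph0 (v0 vP).
by rewrite Fq_emb_unit.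
Qed.

Lemma Fq_approx (x : F) : (0 <= vF x)%E ->
  exists t : Fq, (0 < v (emb x - Fq_emb t)%R)%E.
Proof.
move=> /teichmueller[t [/eqP tq xt]]; exists (MkFq tq).
by rewrite /Fq_emb/= -rmorphB.
Qed.

(* Divide an equation of x by a power of X: its constant term is then a unit,
   although it is congruent to the value of the equation at x. *)
Let vpos_algebraic_eq0 (x : D) : algebraicOver Fq_emb x -> (0 < v x)%E -> x = 0.
Proof.
move=> [p p0 px] x0; apply/eqP; apply: contraT => xn0.
have [m [r]] := multiplicity_XsubC p 0; rewrite p0/= => r0 pE.
have r_neq0 : r != 0 by apply: contraNneq r0 => ->; rewrite root0.
move: px; rewrite pE rmorphM rmorphXn/= map_polyXsubC rmorph0 subr0 rootM.
rewrite /root hornerXn expf_eq0 (negbTE xn0) andbF orbF => /eqP.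
rewrite horner_coef size_map_poly.
rewrite /root horner_coef0 in r0.
have := r_neq0; rewrite -size_poly_gt0; case: (size r) => // k _.
rewrite big_ord_recl/= expr0 mulr1 => /eqP; rewrite addr_eq0 => /eqP rE.
have := Fq_emb_unit r0; rewrite -coef_map rE (vN vP) => vE.
suff : (0 < v (\sum_(i < k) (map_poly Fq_emb r)`_(bump 0 i) * x ^+ bump 0 i)%R)%E.
  by rewrite vE ltxx.
apply: (vpos_sum vP) => i _; rewrite coef_map; apply: (vposM vP).
  exact: Fq_emb_nng.
exact: (vposX vP).
Qed.

(** Nonzero elements algebraic over a finite field are units: neither such an
    element nor its inverse can lie in the maximal ideal. *)
Lemma algebraic_unit (x : D) : algebraicOver Fq_emb x -> x != 0 -> v x = 0%E.
Proof.
move=> xa x0; apply/le_anti/andP; split.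
  by rewrite leNgt; apply: contraNN x0 => /(vpos_algebraic_eq0 xa) ->.
rewrite leNgt -(vV_gt0 vP x0); apply: contraNN x0.
by move=> /(vpos_algebraic_eq0 (algebraic_inv xa))/eqP; rewrite invr_eq0.
Qed.

Lemma algebraic_nng (x : D) : algebraicOver Fq_emb x -> (0 <= v x)%E.
Proof.
move=> xa; have [->|x0] := eqVneq x 0; first by rewrite (v0 vP).
by rewrite algebraic_unit.
Qed.

(** The residue field of C is algebraic over the one of F: an integral element
    is approximated by some y algebraic over F; the equation of y, scaled to
    be primitive, reduces to a nonzero polynomial over Fq, which splits in C
    and vanishes at y modulo the maximal ideal. *)
Lemma residue_algebraic (a : D) : (0 <= v a)%E ->
  exists2 w, algebraicOver Fq_emb w & (0 < v (a - w)%R)%E.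
Proof.
move=> a0; have [_ /(_ a 1)[y [P P0 /eqP Py] ay]] := ld_completed D.
have {}ay : (0 < v (a - y)%R)%E by apply: lt_le_trans ay; rewrite lte_fin.
have y0 := vnng_congr vP a0 ay; have := P0; rewrite -size_poly_gt0 => sP.
have wP := vF_valuation D.
have [j _ jmin] := arg_minP (i0 := Ordinal sP) (P := xpredT)
  (fun i : 'I_(size P) => vF P`_i) isT.
have c0 : P`_j != 0.
  have ls : ((size P).-1 < size P)%N by rewrite prednK.
  have := jmin (Ordinal ls) isT => /=; apply: contraTneq => ->.
  rewrite (v0 wP) leye_eq; apply: (v_neqy wP).
  by rewrite -lead_coefE lead_coef_eq0.
have [s sE] := v_fin wP c0.
have /choice[t tP] : forall i : nat, exists t : Fq, (i < size P)%N ->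
    (0 < v (emb (P`_i / P`_j) - Fq_emb t)%R)%E.
  move=> i; have [iP|_] := boolP (i < size P)%N; last by exists 0.
  have [|t tP] := @Fq_approx (P`_i / P`_j); last by exists t.
  by rewrite (vM wP) (vV wP sE) EFinN sube_ge0// -sE (jmin (Ordinal iP)).
pose h := \poly_(i < size P) t i.
have h0 : h != 0.
  apply/eqP => /(congr1 (fun p : {poly _} => p`_j)); rewrite coef_poly ltn_ord coef0.
  by move=> tj; have := tP j (ltn_ord j); rewrite divff// rmorph1 tj rmorph0 subr0 (v1 vP) ltxx.
have hy : (0 < v (map_poly Fq_emb h).[y])%E.
  have -> : (map_poly Fq_emb h).[y] = (map_poly Fq_emb h).[y] -
      (emb P`_j)^-1 * (map_poly emb P).[y] by rewrite Py mulr0 subr0.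
  rewrite !(@horner_coef_wide _ (size P)) ?size_map_poly ?size_poly//.
  rewrite mulr_sumr -sumrB; apply: (vpos_sum vP) => i _.
  rewrite mulrA -mulrBl; apply: (vposMl vP); last exact: (vnngX vP).
  rewrite !coef_map coef_poly ltn_ord/= mulrC -fmorphV -rmorphM.
  by apply: (vposBC vP); exact: tP.
have [rs hE] := closed_field_poly_normal (map_poly Fq_emb h).
have lc0 : lead_coef h != 0 by rewrite lead_coef_eq0.
have rsa z : z \in rs -> algebraicOver Fq_emb z.
  by exists h => //; rewrite hE rootZ ?lead_coef_map ?fmorph_eq0// root_prod_XsubC.
move: hy; rewrite hE hornerZ lead_coef_map (vM vP) (Fq_emb_unit lc0) add0e.
rewrite horner_prod => /(vpos_prod vP)[z zs|z /rsa za].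
  by rewrite hornerXsubC; apply: (vgeB vP (M := 0)) => //; exact/algebraic_nng/rsa.
by rewrite hornerXsubC => yz; exists z => //; exact: (vpos_trans vP) ay yz.
Qed.

End ConstantField.

Section UnramifiedExtension.
Variables (R : realType) (D : local_data R).
Notation q := (ld_q D).
Notation F := (ld_F D).
Notation emb := (@ld_emb R D).
Notation v := (@ld_v R D).
Notation Fq_emb := (@Fq_emb R D).
Let vP : is_valuation v := ld_valuation D.
Let wP : is_valuation (@vF R D) := vF_valuation D.

Variables (w : D) (h : {poly Fq D}).
Hypotheses (h0 : h != 0) (hw : root (map_poly Fq_emb h) w).
Hypothesis h_min : forall r : {poly Fq D},
  r != 0 -> root (map_poly Fq_emb r) w -> (size h <= size r)%N.

Let n := (size h).-1.
Let w_alg : algebraicOver Fq_emb w. Proof. by exists h. Qed.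
Let wX_nng i : (0 <= v (w ^+ i)%R)%E.
Proof. by apply: (vnngX vP); exact: algebraic_nng. Qed.

Definition lincomb (c : 'I_n -> F) : D := \sum_i emb (c i) * w ^+ i.

Lemma lincombB c c' : lincomb c - lincomb c' = lincomb (fun i => c i - c' i).
Proof. by rewrite -sumrB; apply: eq_bigr => i _; rewrite rmorphB mulrBl. Qed.

Lemma lincombZ a c : emb a * lincomb c = lincomb (fun i => c i * a).
Proof.
by rewrite mulr_sumr; apply: eq_bigr => i _; rewrite mulrA -rmorphM [a * _]mulrC.
Qed.

(** The powers of w stay independent in the residue field: a combination with
    coefficients in Fq is algebraic over Fq, so it lies in the maximal ideal
    only if it is 0, which the minimality of h forbids for nonzero
    coefficients. *)
Lemma lincomb_pos c : (forall i, (0 <= vF (c i))%E) -> (0 < v (lincomb c))%E ->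
  forall i, (0 < vF (c i))%E.
Proof.
move=> c0 c1.
have /choice[t tP] : forall i, exists t : Fq D, (0 < v (emb (c i) - Fq_emb t)%R)%E.
  by move=> i; exact: Fq_approx.
pose r := \poly_(k < n) (if insub k is Some i then t i else 0).
have rE : (map_poly Fq_emb r).[w] = \sum_i Fq_emb (t i) * w ^+ i.
  rewrite (@horner_coef_wide _ n) ?size_map_poly ?size_poly//.
  by apply: eq_bigr => i _; rewrite coef_map coef_poly ltn_ord valK.
have r_alg : algebraicOver Fq_emb (map_poly Fq_emb r).[w].
  apply/integral_algebraic/integral_horner; last exact/integral_algebraic.
  by apply/integral_poly => k; rewrite coef_map; exact: integral_id.
have r_pos : (0 < v (map_poly Fq_emb r).[w])%E.
  rewrite rE -[X in v X](subKr (lincomb c)); apply: (vposB vP) => //.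
  rewrite -sumrB; apply: (vpos_sum vP) => i _; rewrite -mulrBl.
  exact: (vposMl vP).
have r0 : r = 0.
  apply/eqP; apply: contraTT r_pos => rn0.
  rewrite (algebraic_unit r_alg) ?ltxx//; apply/negP => /(h_min rn0).
  rewrite leqNgt => /negP; apply; apply: leq_ltn_trans (size_poly _ _) _.
  by rewrite /n prednK// size_poly_gt0.
move=> i; have ti : t i = 0.
  by have := congr1 (fun p : {poly _} => p`_i) r0; rewrite coef_poly ltn_ord valK coef0.
by have := tP i; rewrite ti rmorph0 subr0.
Qed.

(** The valuation on the span of the powers of w is the Gauss norm: divide by
    the coefficient of least valuation and use that the powers of w are
    independent in the residue field. *)
Lemma lincomb_val c : forall i, (v (lincomb c) <= vF (c i))%E.
Proof.
move=> i; have [j _ jmin] := arg_minP (i0 := i) (P := xpredT) (fun k => vF (c k)) isT.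
apply: le_trans (jmin i isT) => /=; rewrite leNgt; apply/negP => jl.
have cj0 : c j != 0.
  by apply: contraTneq jl => ->; rewrite (v0 wP) -leNgt leey.
have [s sE] := v_fin wP cj0.
suff : (0 < vF (c j / c j))%E by rewrite divff// (v1 wP) ltxx.
apply: (lincomb_pos (c := fun i => c i / c j)) => [k|].
  by rewrite (vM wP) (vV wP sE) EFinN sube_ge0// -sE (jmin k).
by rewrite -lincombZ fmorphV (vM vP) (vV vP sE) addeC EFinN sube_gt0// -sE.
Qed.

(* F(w), as the image of the abstract field obtained by adjoining a root of h. *)
Let K : set D := range (@subfx_inj F D emb w (map_poly val h)).

Let p0 : map_poly (val : Fq D -> F) h != 0. Proof. by rewrite map_poly_eq0. Qed.
Let pw : root (map_poly emb (map_poly (val : Fq D -> F) h)) w.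
Proof. by rewrite -map_poly_comp. Qed.

Let KP x : K x <-> exists c, x = lincomb c.
Proof.
split=> [[y _ <-]|[c ->]]; last first.
  exists (subfx_eval emb w _ (\poly_(k < n) (if insub k is Some i then c i else 0))) => //.
  rewrite (subfx_inj_eval pw p0) (@horner_coef_wide _ n) ?size_map_poly ?size_poly//.
  by apply: eq_bigr => i _; rewrite coef_map coef_poly ltn_ord valK.
have [r ->] := subfxE y; rewrite (subfx_inj_eval pw p0).
exists (fun i => (r %% map_poly val h)`_i).
rewrite {1}(divp_eq r (map_poly val h)) rmorphD rmorphM/= hornerD hornerM.
rewrite (rootP pw) mulr0 add0r (@horner_coef_wide _ n).
  by apply: eq_bigr => i _; rewrite coef_map.
rewrite size_map_poly -ltnS prednK ?size_poly_gt0//.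
by have := ltn_modp r (map_poly val h); rewrite p0 size_map_poly.
Qed.

(** F(w) is unramified over F: by the Gauss norm, its integers are the
    combinations of the powers of w with integral coefficients, so reducing the
    coefficients identifies its residue field with Fq ^ n. *)
Lemma span_finite_unramified : finite_unramified emb v q K.
Proof.
have [t [cls [tq tcls clsU]]] := teichmueller_reps D.
have t0 i : (0 <= vF (t i))%E.
  by apply: fixed_integral; rewrite -rmorphXn tq.
split.
- move=> _ [a _ <-]; exists (subfx_eval emb w _ a%:P) => //.
  by rewrite (subfx_inj_eval pw p0) map_polyC hornerC.
- move=> _ _ [x _ <-] [y _ <-]; split; first by exists (x - y); rewrite ?rmorphB.
    by exists (x * y); rewrite ?rmorphM.
  by exists x^-1; rewrite ?fmorphV.
exists n, (fun i => w ^+ i); split; [exact: KP|split].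
  move=> c c0 i; have := lincomb_val c i; rewrite /lincomb c0 (v0 vP) leye_eq.
  by move=> ci; apply/eqP; apply: contraTT ci => /(v_neqy wP).
have card : #|{ffun 'I_n -> 'I_q}| = (q ^ n)%N by rewrite card_ffun !card_ord.
pose f (m : 'I_(q ^ n)) : {ffun 'I_n -> 'I_q} := enum_val (cast_ord (esym card) m).
have fK : forall phi, exists m, f m = phi.
  by move=> phi; exists (cast_ord card (enum_rank phi)); rewrite /f cast_ordK enum_rankK.
have f_inj : injective f by move=> m m' /enum_val_inj/cast_ord_inj.
exists (fun m => lincomb (fun i => t (f m i))); split=> [m|x /KP[c ->] c0].
  split; first by apply/KP; eexists.
  by apply: (vnng_sum vP) => i _; apply: (vnngM vP); [exact: t0 |exact: wX_nng].
have {}c0 i : (0 <= vF (c i))%E := le_trans c0 (lincomb_val c i).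
have [m fm] := fK [ffun i => cls (c i)].
exists m; split=> [|m'].
  rewrite lincombB fm; apply: (vpos_sum vP) => i _; apply: (vposMl vP) => //.
  by rewrite ffunE; exact: tcls.
rewrite lincombB => /lincomb_pos H; apply: f_inj; rewrite fm; apply/ffunP => i.
rewrite ffunE; apply: clsU => //; apply: H => k.
exact: (vgeB wP (M := 0)).
Qed.

End UnramifiedExtension.

Section InertiaResidue.
Variables (R : realType) (D : local_data R).
Notation q := (ld_q D).
Notation emb := (@ld_emb R D).
Notation v := (@ld_v R D).
Notation Fq_emb := (@Fq_emb R D).
Let vP : is_valuation v := ld_valuation D.

Lemma algebraic_unramified (w : D) : algebraicOver Fq_emb w -> max_unramified emb v q w.
Proof.
move=> [p p0 pw].
have ex : exists m, `[< exists h : {poly Fq D},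
    [/\ h != 0, root (map_poly Fq_emb h) w & size h = m] >].
  by exists (size p); apply/asboolP; exists p.
have [_ /asboolP[h [h0 hw <-]] hmin] := ex_minnP ex.
have h_min (r : {poly Fq D}) : r != 0 -> root (map_poly Fq_emb r) w -> (size h <= size r)%N.
  by move=> r0 rw; apply: hmin; apply/asboolP; exists r.
apply: (ex_intro2 _ _ _ (span_finite_unramified h0 hw h_min)).
exists (subfx_eval emb w _ 'X) => //.
by rewrite subfx_inj_eval ?map_poly_eq0 -?map_poly_comp// map_polyX hornerX.
Qed.

(** Every residue class has a representative algebraic over Fq, and inertia
    fixes it. *)
Lemma inertia_residue (s : inertia D) (a : D) : (0 <= v a)%E -> (0 < v (s a - a)%R)%E.
Proof.
move=> /residue_algebraic[w /algebraic_unramified/(in_fix s) sw aw].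
have -> : s a - a = s (a - w) - (a - w) by rewrite rmorphB/= sw; ring.
by apply: (vposB vP); rewrite ?inertia_isometry.
Qed.

End InertiaResidue.

(** * The equation of the reduction *)

Section Slopes.
Variables (R : realFieldType) (Q : R).

Lemma LT2_slopes (e t : R) : 2 <= Q -> 1 + t = Q * t ->
  (1 + e <= t) || (Q * e <= t) -> (1 + e <= Q * e) || (t <= Q * e) ->
  e = (Q * (Q - 1))^-1.
Proof.
move=> Q2 tq H1 H2; have Q0 : Q * (Q - 1) != 0 by apply/lt0r_neq0/mulr_gt0; lra.
apply: (mulIf Q0); rewrite mulVf//; suff Qe : Q * e = t.
  have -> : e * (Q * (Q - 1)) = (Q * e) * (Q - 1) by ring.
  by rewrite Qe; lra.
by case/orP: H1; case/orP: H2; nra.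
Qed.

(** With r the valuation of z, the term z ^ q has valuation Q * r, and the
    left-hand sides bound from below the valuations of the competing terms, the
    last one being the constant term. *)
Lemma slopes_dominated (c r : R) : 2 <= Q -> 0 < c -> r < 0 -> - ((Q ^+ 2 - 1) * c) <= r ->
  ~~ ((Q * r + c <= Q * r) || (r <= Q * r) ||
     ((Q ^+ 2 * r + (Q ^+ 2 - 1) ^+ 2 * c <= Q * r) || (0 <= Q * r))).
Proof.
move=> Q2 c0 r0 rc; have Q1 : 0 < Q - 1 by lra.
have k1 : (Q - 1) * r < 0 by rewrite pmulr_rlt0.
have k2 : Q * (Q - 1) * r >= - (Q * (Q - 1) * ((Q ^+ 2 - 1) * c)).
  by rewrite -mulrN ler_wpM2l//; nra.
have k3 : Q * (Q - 1) * ((Q ^+ 2 - 1) * c) < (Q ^+ 2 - 1) ^+ 2 * c.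
  rewrite expr2 -[X in _ < X]mulrA ltr_pM2r; first nra.
  by rewrite pmulr_lgt0//; nra.
have k4 : Q ^+ 2 * r = Q * (Q - 1) * r + Q * r by ring.
have k5 : (Q ^+ 2 - 1) ^+ 2 * c - Q * (Q - 1) * ((Q ^+ 2 - 1) * c) > 0 by lra.
rewrite !negb_or -!ltNge k4; apply/andP; split; apply/andP; split; nra.
Qed.

End Slopes.

Section Valuations.
Variables (R : realType) (D : local_data R).
Notation q := (ld_q D).
Notation v := (@ld_v R D).
Let vP : is_valuation v := ld_valuation D.
Let Q : R := q%:R.
Let Q2 : 2 <= Q. Proof. by rewrite ler_nat q_gt1. Qed.

(** The Newton polygon of the polynomial killed by pi2, first at the nonzero
    root mul_LT pi2 of mul_LT, then at pi2. *)
Lemma v_LT2_generator (pi2 : D) : is_LT2_generator pi2 ->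
  v pi2 = ((Q * (Q - 1))^-1)%:E.
Proof.
rewrite /is_LT2_generator; set T := mul_LT pi2; move=> [TT /eqP T0].
have pi0 : pi2 != 0.
  apply: contraNneq T0 => pi0.
  by rewrite /T /mul_LT pi0 mulr0 expr0n (gtn_eqF (q_gt0 D)) subr0.
have [e eE] := v_fin vP pi0; have [t tE] := v_fin vP T0.
have vu := v_unif D.
have pe : v (unif D * pi2) = (1 + e)%:E by rewrite (vM vP) vu eE.
have qe : v (pi2 ^+ q) = (Q * e)%:E by rewrite (vX vP _ eE) mulr_natl.
have tq : 1 + t = Q * t.
  have : unif D * T = T ^+ q by apply/eqP; rewrite -subr_eq0; apply/eqP; exact: TT.
  by move=> /(congr1 v); rewrite (vM vP) vu tE (vX vP _ tE) -EFinD mulr_natl => -[].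
have H1 := vgeB vP (M := Order.min (1 + e) (Q * e)) (x := unif D * pi2) (y := pi2 ^+ q).
have H2 := vgeB vP (M := Order.min (1 + e) t) (x := unif D * pi2) (y := T).
move: H1 H2; rewrite -[_ - T]/(_ - (unif D * pi2 - pi2 ^+ q)) subKr -/(mul_LT pi2) -/T.
rewrite pe qe tE !lee_fin !ge_min !lexx !orbT => /(_ isT isT) H1 /(_ isT isT) H2.
by rewrite eE (LT2_slopes Q2 tq H1 H2).
Qed.

(** Newton polygon argument: if v z < 0, then z ^ q is the dominant term. *)
Lemma newton_integral (c : R) (z e1 W e2 e3 : D) : 0 < c ->
  ((- ((Q ^+ 2 - 1) * c))%:E <= v z)%E ->
  (0 <= v W)%E -> (c%:E <= v e1)%E -> (c%:E <= v e2)%E ->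
  (((Q ^+ 2 - 1) ^+ 2 * c)%:E <= v e3)%E ->
  z ^+ q * (1 - e1) - z * (W + e2) - z ^+ (q ^ 2) * e3 = 1 ->
  (0 <= v z)%E.
Proof.
move=> c0 z1 W0 e1c e2c e3c E.
have [->|zn0] := eqVneq z 0; first by rewrite (v0 vP).
have [r rE] := v_fin vP zn0; rewrite rE lee_fin leNgt; apply/negP => r0.
move: z1; rewrite rE lee_fin => z1.
have E' : z ^+ q = z ^+ q * e1 + z * (W + e2) + z ^+ (q ^ 2) * e3 + 1 by rewrite -E; ring.
(* The least valuation that the other terms allow. *)
pose m := Order.min (Order.min (Q * r + c) r) (Order.min (Q ^+ 2 * r + (Q ^+ 2 - 1) ^+ 2 * c) 0).
have : (m%:E <= v (z ^+ q))%E.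
  rewrite E'; apply: (vgeD vP); [apply: (vgeD vP); [apply: (vgeD vP)|]|].
  - apply: (vge_le (M := Q * r + c)); first by rewrite /m !ge_min lexx.
    by apply: (vgeM vP) => //; rewrite (vX vP _ rE) lee_fin mulr_natl.
  - apply: (vge_le (M := r + 0)); first by rewrite addr0 /m !ge_min lexx !orbT.
    apply: (vgeM vP); first by rewrite rE.
    apply: (vgeD vP (M := 0)) => //; apply: le_trans e2c; rewrite lee_fin; exact: ltW.
  - apply: (vge_le (M := Q ^+ 2 * r + (Q ^+ 2 - 1) ^+ 2 * c)).
      by rewrite /m !ge_min lexx !orbT.
    by apply: (vgeM vP) => //; rewrite (vX vP _ rE) lee_fin -natrX mulr_natl.
  - by rewrite (v1 vP) lee_fin /m !ge_min lexx !orbT.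
rewrite (vX vP _ rE) lee_fin -mulr_natl -/Q /m !ge_min; apply/negP.
exact: slopes_dominated.
Qed.

End Valuations.

(** The index i stands for the power q ^ i, with X2 = a and Y2 = A * y.  Each
    term of mu2 is a determinant of two conjugates of (X2, Y2), and every such
    determinant is a combination of the conjugates of X2 ^ q * Y2 - X2 * Y2 ^ q
    with coefficients in Y2 alone, so X2 can be eliminated in favour of z. *)
Lemma mu2_moore (K : fieldType)
    (a a1 a2 a3 y y1 y2 y3 A A1 A2 A3 A4 u u1 p p1 z z1 z2 : K) :
  [/\ y1 != 0, y2 != 0 & A1 != 0] -> A2 != 0 -> A3 != 0 ->
  a1 * (A * y) - a * (A1 * y1) = A1 * A2 * z ->
  a2 * (A1 * y1) - a1 * (A2 * y2) = A2 * A3 * z1 ->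
  a3 * (A2 * y2) - a2 * (A3 * y3) = A3 * A4 * z2 ->
  (a2 + u * a1 + p * a) * (A1 * y1) - (a3 + u1 * a2 + p1 * a1) * (A * y)
    - a1 * (A2 * y2 + u * (A1 * y1) + p * (A * y))
    + a * (A3 * y3 + u1 * (A2 * y2) + p1 * (A1 * y1)) = A2 * A3 ->
  z1 * (1 - (A * A3 / (A1 * A2) * (y * y3 / (y1 * y2)) + u1 * (A / A1) * (y / y1)))
    - z * (y3 / y1 + ((p + p1) * (A1 / A3) + u1 * (A2 / A3) * (y2 / y1)))
    - z2 * (A * A4 / (A2 * A2) * (y / y2)) = 1.
Proof.
move=> [y10 y20 A10] A20 A30 d0 d1 d2 mu.
set b := A * y in d0 mu *; set b1 := A1 * y1 in d0 d1 mu *.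
set b2 := A2 * y2 in d1 d2 mu *; set b3 := A3 * y3 in d2 mu *.
have b10 : b1 != 0 by rewrite mulf_neq0.
have b20 : b2 != 0 by rewrite mulf_neq0.
(* Both determinants below come from the Pluecker relations between the
   vectors (a, a1, a2, a3) and (b, b1, b2, b3). *)
have D2 : a2 * b - a * b2 = (b * (A2 * A3 * z1) + A1 * A2 * z * b2) / b1.
  by rewrite -d0 -d1; field.
have D3 : a3 * b - a * b3 = b * (A3 * A4 * z2) / b2 + b * b3 * (A2 * A3 * z1) / (b1 * b2)
    + b3 * (A1 * A2 * z) / b1.
  by rewrite -d0 -d1 -d2; field; rewrite b10 b20.
have E : A2 * A3 = A2 * A3 * z1 - (p + p1) * (A1 * A2 * z) - (a3 * b - a * b3)
   - u1 * (a2 * b - a * b2).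
  by rewrite -[LHS]mu -d0 -d1; ring.
have A230 : A2 * A3 != 0 by rewrite mulf_neq0.
apply: (mulfI A230); rewrite mulr1 [RHS]E D2 D3 /b /b1 /b2 /b3; field.
by rewrite ?y10 ?y20 ?A10 ?A20 ?A30.
Qed.

Section CoordinateBounds.
Variables (R : realFieldType) (Q c : R).

(** Bounds for the coefficients in the equation of z: c, Q ^ i * c,
    (Q - 1) * Q ^ 3 * c and Q ^ 3 * (Q ^ 2 - 1) * c are the valuations of
    alpha, alpha ^ (q ^ i), u and pi. *)
Lemma pow_bounds : 2 <= Q -> 0 < c ->
  [/\ c <= (c + Q ^+ 3 * c) - (Q * c + Q ^+ 2 * c),
      c <= Q * ((Q - 1) * Q ^+ 3 * c) + (c - Q * c),
      c <= Q ^+ 3 * (Q ^+ 2 - 1) * c + (Q * c - Q ^+ 3 * c),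
      c <= Q * (Q ^+ 3 * (Q ^+ 2 - 1) * c) + (Q * c - Q ^+ 3 * c) &
      c <= Q * ((Q - 1) * Q ^+ 3 * c) + (Q ^+ 2 * c - Q ^+ 3 * c)].
Proof.
move=> Q2 c0.
have key P : 0 <= P -> 0 <= P * c by move=> P0; rewrite mulr_ge0// ltW.
have Q3 : 2 * Q ^+ 2 <= Q ^+ 3 by rewrite exprS ler_wpM2r// sqr_ge0.
have Q4 : 2 * Q <= Q ^+ 2 by rewrite expr2 ler_wpM2r//; lra.
have Q5 : 2 * Q ^+ 3 <= Q ^+ 4 by rewrite [Q ^+ 4]exprS ler_wpM2r//; lra.
have Q6 : 2 * Q ^+ 4 <= Q ^+ 5 by rewrite [Q ^+ 5]exprS ler_wpM2r//; lra.
have Q7 : 2 * Q ^+ 5 <= Q ^+ 6 by rewrite [Q ^+ 6]exprS ler_wpM2r//; lra.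
split; rewrite -subr_ge0.
- by have := @key (Q ^+ 3 - Q - Q ^+ 2); lra.
- by have := @key (Q ^+ 5 - Q ^+ 4 - Q); lra.
- by have := @key (Q ^+ 5 - 2 * Q ^+ 3 + Q - 1); lra.
- by have := @key (Q ^+ 6 - Q ^+ 4 + Q - Q ^+ 3 - 1); lra.
- by have := @key (Q ^+ 5 - Q ^+ 4 + Q ^+ 2 - Q ^+ 3 - 1); lra.
Qed.

End CoordinateBounds.

Section Coordinates.
Variables (R : realType) (D : local_data R) (pi2 alpha : D).
Notation q := (ld_q D).
Notation v := (@ld_v R D).
Notation c := (@val_2 R D).
Let vP : is_valuation v := ld_valuation D.
Let Q : R := q%:R.
Let Q2 : 2 <= Q. Proof. by rewrite ler_nat q_gt1. Qed.

Hypothesis hpi2 : is_LT2_generator pi2.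
Hypothesis halpha : alpha ^+ (q ^ 2 * (q + 1)) = pi2.

Let vMr x y (r s : R) : v x = r%:E -> v y = s%:E -> v (x * y) = (r + s)%:E.
Proof. by rewrite (vM vP) => -> ->. Qed.

Let vDr x y (r s : R) : v x = r%:E -> v y = s%:E -> v (x / y) = (r - s)%:E.
Proof. by move=> xr ys; apply: vMr => //; exact: vV. Qed.

Let vXr x n (r : R) : v x = r%:E -> v (x ^+ n) = (n%:R * r)%:E.
Proof. by move=> xr; rewrite (vX vP _ xr) mulr_natl. Qed.

Let v_neq0 x (r : R) : v x = r%:E -> x != 0.
Proof. by apply: contra_eqN => /eqP ->; rewrite (v0 vP). Qed.

Lemma moore_frobenius (X Y A z : D) : X ^+ q * Y - X * Y ^+ q = A ^+ q * A ^+ (q ^ 2) * z ->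
  X ^+ (q ^ 2) * Y ^+ q - X ^+ q * Y ^+ (q ^ 2) = A ^+ (q ^ 2) * A ^+ (q ^ 3) * z ^+ q /\
  X ^+ (q ^ 3) * Y ^+ (q ^ 2) - X ^+ (q ^ 2) * Y ^+ (q ^ 3) =
    A ^+ (q ^ 3) * A ^+ (q ^ 4) * z ^+ (q ^ 2).
Proof.
move=> m0; split.
  have /= := congr1 (fun a => a ^+ q) m0.
  by rewrite frobB1 !exprMn -!exprM -!expnSr !mulnn.
have /= := congr1 (fun a => a ^+ (q ^ 2)) m0.
by rewrite frobB !exprMn -!exprM -!expnD -!expnS.
Qed.

Lemma val_2_gt0 : 0 < c.
Proof.
rewrite invr_gt0; move: Q2; rewrite /Q; set x := q%:R; move: x => x x2.
by rewrite mulr_gt0 ?exprn_gt0//; nra.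
Qed.

Lemma v_alpha : v alpha = c%:E.
Proof.
have := v_LT2_generator hpi2; rewrite -/Q -halpha.
have [->|/(v_fin vP)[r rE]] := eqVneq alpha 0.
  by rewrite expr0n muln_eq0 expn_eq0 addn1 (gtn_eqF (q_gt0 D)) (v0 vP).
rewrite rE (vXr _ rE) natrM natrX natrD -/Q => -[] E; congr (_%:E).
rewrite /val_2 -/Q; move: Q Q2 E => x x2 E.
have x0 : x != 0 by apply: lt0r_neq0; lra.
have x1 : x - 1 != 0 by apply: lt0r_neq0; lra.
have x3 : x + 1 != 0 by apply: lt0r_neq0; lra.
have x4 : x ^+ 2 * (x + 1) != 0 by rewrite mulf_neq0// expf_neq0.
apply: (mulfI x4); rewrite E.
have x5 : x ^+ 2 - 1 != 0 by rewrite -[1](expr1n _ 2) subr_sqr mulf_neq0.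
by field; rewrite x0 x1 x5.
Qed.

(** All valuations in sight are integral multiples of the one of alpha; the 1
    below is the valuation of pi. *)
Lemma val_scaling : (1 = Q ^+ 3 * (Q ^+ 2 - 1) * c) * (val_u D = (Q - 1) * Q ^+ 3 * c).
Proof.
rewrite /val_u /val_2 -/Q; move: Q Q2 => x x2.
have x0 : x != 0 by apply: lt0r_neq0; lra.
have x3 : x + 1 != 0 by apply: lt0r_neq0; lra.
have x5 : x ^+ 2 - 1 != 0 by apply: lt0r_neq0; nra.
split; first by rewrite divff// mulf_neq0// expf_neq0.
by field; rewrite x0 x3 x5.
Qed.

Section Point.
Variable P : Y31c pi2.
Notation x := (co_x alpha P).
Notation y := (co_y alpha P).
Notation z := (co_z alpha P).

Let alpha0 : alpha != 0. Proof. exact: v_neq0 v_alpha. Qed.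

Let vx : v x = 0%:E.
Proof. by rewrite (vDr (pt_vX2 P) v_alpha) subrr. Qed.

Lemma co_y_val : v y = 0%:E.
Proof. by rewrite (vDr (pt_vY2 P) v_alpha) subrr. Qed.

Let y0 : y != 0. Proof. exact: v_neq0 co_y_val. Qed.

Let vy n : v (y ^+ n) = 0%:E. Proof. by rewrite (vXr _ co_y_val) mulr0. Qed.
Let vA n : v (alpha ^+ n) = (n%:R * c)%:E. Proof. exact: vXr v_alpha. Qed.

Lemma co_z_lower : ((- ((Q ^+ 2 - 1) * c))%:E <= v z)%E.
Proof.
rewrite -[- _]add0r; apply: (vgeM vP).
  by apply: (vgeB vP); rewrite -[X in (X%:E <= _)%E]addr0; apply: (vgeM vP);
    rewrite ?(vXr _ vx) ?mulr0 ?vy ?vx ?co_y_val.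
rewrite (vV vP (vA _)) natrB ?natrX// expn_gt0 (q_gt0 D)//.
Qed.

Let moore : pt_X2 P ^+ q * pt_Y2 P - pt_X2 P * pt_Y2 P ^+ q =
  alpha ^+ q * alpha ^+ (q ^ 2) * z.
Proof.
have -> : alpha ^+ (q ^ 2) = alpha * alpha ^+ (q ^ 2 - 1).
  by rewrite -exprS subn1 prednK// expn_gt0 (q_gt0 D).
have A1 : alpha ^+ (q ^ 2 - 1) != 0 by rewrite expf_neq0.
rewrite /co_z /co_x /co_y !expr_div_n; field.
by rewrite A1 alpha0 expf_neq0.
Qed.

(** The equation mu2 = pi2 divided by pi2 = alpha ^ (q ^ 2) * alpha ^ (q ^ 3);
    about u and pi, only the valuations matter. *)
Lemma co_moore_equation : exists e1 e2 e3,
  [/\ (c%:E <= v e1)%E, (c%:E <= v e2)%E, (((Q ^+ 2 - 1) ^+ 2 * c)%:E <= v e3)%E &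
   z ^+ q * (1 - e1) - z * (y ^+ (q ^ 3) / y ^+ q + e2) - z ^+ (q ^ 2) * e3 = 1].
Proof.
have [b1 b2 b3 b4 b5] := pow_bounds Q2 val_2_gt0.
have XE (a : D) n : (a ^+ (q ^ n)) ^+ q = a ^+ (q ^ n.+1) by rewrite -exprM -expnSr.
have XE1 (a : D) : (a ^+ q) ^+ q = a ^+ (q ^ 2) by rewrite -exprM.
have Y2E n : pt_Y2 P ^+ n = alpha ^+ n * y ^+ n by rewrite -exprMn mulrC divfK.
have m0 := moore.
have [m1 m2] := moore_frobenius m0.
have [u0 _ _ mu] := pt_curve P.
have frobD1 (a b : D) : (a + b) ^+ q = a ^+ q + b ^+ q by have := frobD 1 a b; rewrite expn1.
have pi2E : pi2 = alpha ^+ (q ^ 2) * alpha ^+ (q ^ 3).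
  by rewrite -halpha -exprD; congr (_ ^+ _); rewrite addn1 mulnS addnC mulnC -expnS addnC.
have {}mu := etrans mu pi2E; rewrite /mu2 /mul_pi !frobD1 !exprMn !XE1 !XE in mu.
have Y1 := Y2E 1; rewrite !expr1 in Y1.
rewrite !Y2E Y1 in m0 m1 m2 mu.
have A0 k : alpha ^+ k != 0 by rewrite expf_neq0.
have yn0 k : y ^+ k != 0 by rewrite expf_neq0.
have := mu2_moore (And3 (yn0 _) (yn0 _) (A0 _)) (A0 _) (A0 _) m0 m1 m2 mu.
have [sc_pi sc_u] := val_scaling.
have vu := v_unif D; rewrite sc_pi in vu.
have vuq := vXr q (pt_vu P); rewrite -/Q sc_u in vuq.
have vpq := vXr q vu; rewrite -/Q in vpq.
have vA1 := vA 1; rewrite expr1 mul1r in vA1.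
have vy1 := co_y_val.
have vyy k l : v (y ^+ k / y ^+ l) = 0%:E by rewrite (vDr (vy k) (vy l)) subrr.
have vy1y k : v (y / y ^+ k) = 0%:E by rewrite (vDr vy1 (vy k)) subrr.
move=> E; do 3 eexists; split; last exact: E.
- apply: (vgeD vP).
    rewrite (vMr (vDr (vMr vA1 (vA _)) (vMr (vA _) (vA _)))
       (vDr (vMr vy1 (vy _)) (vMr (vy _) (vy _)))).
    by rewrite !addr0 subrr addr0 lee_fin !natrX.
  rewrite (vMr (vMr vuq (vDr vA1 (vA _))) (vy1y _)) addr0 lee_fin.
  exact: b2.
- apply: (vgeD vP).
    rewrite mulrDl; apply: (vgeD vP).
      by rewrite (vMr vu (vDr (vA _) (vA _))) lee_fin !natrX.
    by rewrite (vMr vpq (vDr (vA _) (vA _))) lee_fin !natrX.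
  rewrite (vMr (vMr vuq (vDr (vA _) (vA _))) (vyy _ _)) addr0 lee_fin !natrX.
  exact: b5.
- rewrite (vMr (vDr (vMr vA1 (vA _)) (vMr (vA _) (vA _))) (vy1y _)) addr0.
  rewrite lee_fin !natrX -/Q le_eqVlt; apply/orP; left; apply/eqP; ring.
Qed.

(** The trivial lower bound on the valuation of z suffices to start the Newton
    polygon argument. *)
Lemma co_z_integral : (0 <= v z)%E.
Proof.
have [e1 [e2 [e3 [v1 v2 v3 E]]]] := co_moore_equation.
apply: newton_integral val_2_gt0 co_z_lower _ v1 v2 v3 E.
by rewrite (vDr (vy _) (vy _)) subrr.
Qed.

Lemma co_YE : co_Y alpha P = y.
Proof. by rewrite /co_Y /co_t !div1r invrK. Qed.

Lemma co_X_integral : (0 <= v (co_X alpha P))%E.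
Proof.
rewrite /co_X /co_t (vnngM vP) ?(vN vP) ?co_z_integral// (vnngX vP)//.
by rewrite div1r (vV vP co_y_val) oppr0.
Qed.

(** The equation of the reduction holds up to an error whose valuation is
    bounded below uniformly on the affinoid. *)
Lemma co_equation : (c%:E <= v (- co_X alpha P ^+ q * co_Y alpha P ^+ (q ^ 2)
  + co_X alpha P * co_Y alpha P ^+ (q ^ 3) - 1)%R)%E.
Proof.
have [e1 [e2 [e3 [v1 v2 v3 E]]]] := co_moore_equation.
have z0 := co_z_integral; have c0 := val_2_gt0.
have zX k : (0%:E <= v (z ^+ k))%E := vnngX vP k z0.
have -> : - co_X alpha P ^+ q * co_Y alpha P ^+ (q ^ 2)
    + co_X alpha P * co_Y alpha P ^+ (q ^ 3) - 1 =
    z ^+ q * e1 + z * e2 + z ^+ (q ^ 2) * e3.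
  rewrite -[X in _ - X]E co_YE /co_X /co_t div1r.
  have -> : (- z * y^-1 ^+ q) ^+ q = - (z ^+ q / y ^+ (q ^ 2)).
    have := frobB1 0 (z * y^-1 ^+ q).
    rewrite !sub0r mulNr => ->; rewrite expr0n (gtn_eqF (q_gt0 D)) sub0r.
    by rewrite exprMn -exprM exprVn.
  rewrite exprVn; field.
  by rewrite !expf_neq0.
apply: (vgeD vP); [apply: (vgeD vP)|]; rewrite -[c]add0r; apply: (vgeM vP) => //.
apply: le_trans v3; rewrite lee_fin ler_peMl//; first exact: ltW.
by rewrite exprn_ege1// -subr_ge0; move: Q Q2 => r r2; nra.
Qed.

End Point.
End Coordinates.

(** * The coordinate functions *)

Section Analytic.
Variables (R : realType) (D : local_data R) (pi2 : D).
Notation q := (ld_q D).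
Notation v := (@ld_v R D).
Let vP : is_valuation v := ld_valuation D.
Implicit Types (f g : Y31c pi2 -> D).

Lemma analytic_monomial (nu : exponent) : analytic (@monomial R D pi2 nu).
Proof.
exists (fun mu => if mu == nu then 1 else 0); split.
  apply/strictly_convergentP => M; exists [fset nu]%fset => mu.
  by rewrite inE => /negPf ->; rewrite (v0 vP) leey.
move=> P M; exists [fset nu]%fset => T T0.
rewrite (big_fsetD1 nu)/=; last by rewrite -fsub1set.
rewrite eqxx mul1r big_seq big1 ?addr0 ?subrr; first exact: (vge0 vP).
by move=> i; rewrite !inE => /andP[/negPf ->]; rewrite mul0r.
Qed.

Lemma analytic_coordX (i : 'I_5) (n : int) :
  analytic (fun P : Y31c pi2 => Defs.coord P i ^ n).
Proof.
suff <- : @monomial R D pi2 [ffun j => if j == i then n else 0] = fun P => Defs.coord P i ^ n.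
  exact: analytic_monomial.
apply/funext => P; rewrite /monomial (bigD1 i)//= ffunE eqxx.
by rewrite big1 ?mulr1// => j /negPf ji; rewrite ffunE ji expr0z.
Qed.

Lemma analyticX f n : analytic f -> analytic (fun P => f P ^+ n).
Proof.
move=> fa; elim: n => [|n IH]; first exact: analytic_cst.
suff -> : (fun P => f P ^+ n.+1) = f * (fun P => f P ^+ n) by exact: analyticM.
by apply/funext => P; rewrite exprS.
Qed.

Lemma co_y_analytic alpha : analytic (@co_y R D pi2 alpha).
Proof. exact: analyticM (analytic_coordX (@Ordinal 5 4 isT) 1) (analytic_cst pi2 alpha^-1). Qed.

Lemma co_x_analytic alpha : analytic (@co_x R D pi2 alpha).
Proof. exact: analyticM (analytic_coordX (@Ordinal 5 3 isT) 1) (analytic_cst pi2 alpha^-1). Qed.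

Lemma co_t_analytic alpha : analytic (@co_t R D pi2 alpha).
Proof.
suff -> : co_t alpha = (cst alpha) * (fun P : Y31c pi2 => Defs.coord P (@Ordinal 5 4 isT) ^ (-1)).
  by apply: analyticM; [exact: analytic_cst|exact: analytic_coordX].
by apply/funext => P; rewrite /co_t /co_y div1r invf_div.
Qed.

Lemma co_z_analytic alpha : analytic (@co_z R D pi2 alpha).
Proof.
apply: (analyticM (g := cst _)); last exact: analytic_cst.
have xa := co_x_analytic alpha; have ya := co_y_analytic alpha.
by apply: analyticB; apply: analyticM => //; exact: analyticX.
Qed.

Lemma co_X_analytic alpha : analytic (@co_X R D pi2 alpha).
Proof.
suff -> : co_X alpha = cst (-1) * co_z alpha * (fun P : Y31c pi2 => co_t alpha P ^+ q).
  apply: analyticM; last exact/analyticX/co_t_analytic.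
  by apply: analyticM; [exact: analytic_cst|exact: co_z_analytic].
by apply/funext => P; rewrite /co_X -[- co_z _ _]mulN1r.
Qed.

Lemma cst_pb (a : D) : (0 <= v a)%E -> cst a \in @pb_analytic R D pi2.
Proof.
move=> a0; apply/asboolP; split; first exact: analytic_cst.
by apply/power_boundedP.
Qed.

Lemma rclassE f (fpb : f \in @pb_analytic R D pi2) : rclass f = redn (MkAint fpb).
Proof. by congr redn; apply/val_inj; rewrite insubdK. Qed.

Lemma Aint_exprE (f : Aint pi2) n P : (f ^+ n) P = f P ^+ n.
Proof.
elim: n => [|n IH]; first by rewrite !expr0.
by rewrite exprS -[LHS]/(f P * (f ^+ n) P) IH exprS.
Qed.

Lemma eq_on_eq (Z : set (spec (Ared pi2))) (a b : Ared pi2) : a = b -> eq_on Z a b.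
Proof. by move=> -> p _; rewrite subrr; case: (spec_prime p). Qed.

Lemma redn_eq_lb (f g : Aint pi2) (e : R) : 0 < e ->
  (forall P, (e%:E <= v (f P - g P)%R)%E) -> redn f = redn g.
Proof.
move=> e0 fg; apply/redn_eq/asboolP/topologically_nilpotentP.
by exists e.
Qed.

End Analytic.

(** * The inertia action *)

Section SpecHomeomorphism.

Lemma spec_map_continuous (A B : comPzRingType) (f : {rmorphism A -> B}) :
  continuous (spec_map f).
Proof.
apply/continuousP => _ [E ->]; exists (f @` E).
rewrite preimage_setC; congr (~` _); apply/seteqP; split => p /= pE.
  by move=> _ [a /pE ? <-].
by move=> a Ea; apply: pE; exists a.
Qed.

Lemma homeo_connected_component (T : topologicalType) (f g : T -> T) x :
  continuous f -> continuous g -> cancel f g -> cancel g f ->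
  f @` connected_component setT x = connected_component setT (f x).
Proof.
move=> fc gc fK gK.
have sub (h : T -> T) y : continuous h ->
    h @` connected_component setT y `<=` connected_component setT (h y).
  move=> hc; apply: connected_component_max => //.
    by exists y => //; exact: connected_component_refl.
  apply: connected_continuous_connected; first exact: component_connected.
  exact: continuous_subspaceT.
apply/seteqP; split; first exact: sub.
move=> y xy; exists (g y); last exact: gK.
by rewrite -[x]fK; apply: sub => //; exists y.
Qed.

End SpecHomeomorphism.

Section InverseInertia.
Variables (R : realType) (D : local_data R).

Lemma inertia_inv_fix (s : inertia D) x :
  max_unramified (@ld_emb R D) (@ld_v R D) (ld_q D) x -> in_inv s x = x.
Proof. by move=> /(in_fix s) sx; rewrite -{1}sx in_funK. Qed.

Definition inertia_inv (s : inertia D) : inertia D :=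
  @Inertia R D (in_inv s) s (@in_invK R D s) (@in_funK R D s)
    (@in_inv_cont R D s) (@in_cont R D s) (@inertia_inv_fix s).

Lemma inertia_inv_id (s : inertia D) (a : D) : s a = a -> inertia_inv s a = a.
Proof. by move=> sa; rewrite -{1}sa /= in_funK. Qed.

Variable pi2 : D.

Lemma Ared_sigma_cancel (s s' : inertia D) (hs : s pi2 = pi2) (hs' : s' pi2 = pi2) :
  in_inv s' = s -> s' =1 in_inv s ->
  cancel (Ared_sigma hs) (Ared_sigma hs').
Proof.
move=> s's ss' a; have [f <-] := redn_surj a; rewrite !Ared_sigmaE; congr redn.
apply/val_inj/funext => P; rewrite /= /fun_sigma /= /fun_sigma ss' in_funK.
by congr (Aint_fun f _); apply: Y31c_eq; rewrite /= s's in_funK.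
Qed.

Lemma red_sigma_cancel (s s' : inertia D) (hs : s pi2 = pi2) (hs' : s' pi2 = pi2) :
  cancel (Ared_sigma hs') (Ared_sigma hs) -> cancel (red_sigma hs) (red_sigma hs').
Proof.
move=> K p; apply: spec_eq; apply/funext => a; rewrite /= /preimage.
by rewrite /= K.
Qed.

End InverseInertia.

Section Action.
Variables (R : realType) (D : local_data R) (pi2 : D) (s : inertia D).
Hypothesis hs : s pi2 = pi2.
Notation q := (ld_q D).
Notation v := (@ld_v R D).
Let vP : is_valuation v := ld_valuation D.

Lemma Ared_sigma_rclass f : f \in @pb_analytic R D pi2 ->
  Ared_sigma hs (rclass f) = rclass (fun_sigma hs f).
Proof.
move=> fpb; rewrite rclassE Ared_sigmaE rclassE; first exact: fun_sigma_pb.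
by move=> gpb; congr redn; exact/val_inj.
Qed.

Lemma rclassM f g : f \in @pb_analytic R D pi2 -> g \in @pb_analytic R D pi2 ->
  rclass f * rclass g = rclass (f * g).
Proof.
move=> fpb gpb; rewrite !rclassE ?rpredM// => fgpb.
by rewrite -rmorphM; congr redn; exact/val_inj.
Qed.

(** Constants of the reduction lie in the residue field, on which inertia acts
    trivially. *)
Lemma Ared_sigma_cst (a : D) : (0 <= v a)%E ->
  Ared_sigma hs (rclass (cst a)) = rclass (cst a) :> Ared pi2.
Proof.
move=> a0; have apb := cst_pb pi2 a0; rewrite rclassE Ared_sigmaE.
have [e e0 ae] : exists2 e : R, 0 < e & (e%:E <= v (s a - a)%R)%E.
  have := inertia_residue s a0.
  have [->|/(v_fin vP)[r ->]] := eqVneq (s a - a) 0; last by exists r.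
  by exists 1; rewrite // (v0 vP) leey.
exact: (redn_eq_lb (e := e)).
Qed.

(** Inertia moves the value a of a function that it scales by k to k * a, as it
    fixes the constants. *)
Lemma red_sigma_coord (p : spec (Ared pi2)) f (k a : D) :
  f \in @pb_analytic R D pi2 -> (0 <= v k)%E -> (0 <= v a)%E ->
  Ared_sigma hs (rclass f) = rclass (cst k) * rclass f ->
  spec_ideal p (rclass f - rclass (cst a)) ->
  spec_ideal (red_sigma hs p) (rclass f - rclass (cst (k * a))).
Proof.
move=> fpb k0 a0 fs pa; rewrite /= rmorphB/= fs.
rewrite Ared_sigma_cst ?(vnngM vP)//.
have -> : rclass (cst (k * a)) = rclass (cst k) * rclass (cst a) :> Ared pi2.
  by rewrite rclassM ?cst_pb.
by rewrite -mulrBr; case: (spec_prime p) => _ _ pM _ _; exact: pM.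
Qed.

Lemma ratio_sigma : fun_sigma hs (@Defs.ratio R D pi2) = @Defs.ratio R D pi2.
Proof. by apply/funext => P; rewrite /fun_sigma /Defs.ratio fmorph_div !in_invK. Qed.

(** The action is a homeomorphism fixing the classes of X2 / Y2 and of eta, so
    it sends Z to a component with the property that characterizes Z. *)
Lemma component_sigma (eta : D) (Z : set (spec (Ared pi2))) :
  eta ^+ q = eta -> is_component eta Z -> [set red_sigma hs p | p in Z] = Z.
Proof.
move=> etaq [[[p0 Zp0] Zeta] Zuniq].
have hs' := inertia_inv_id hs.
have AK : cancel (Ared_sigma hs) (Ared_sigma hs') by exact: Ared_sigma_cancel.
have AK' : cancel (Ared_sigma hs') (Ared_sigma hs).
  by apply: Ared_sigma_cancel => // x; rewrite /= in_funK.
apply: Zuniq; split.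
  exists (red_sigma hs p0); rewrite Zp0; apply: homeo_connected_component.
  - exact: spec_map_continuous.
  - exact: (@spec_map_continuous _ _ (Ared_sigma hs')).
  - exact: red_sigma_cancel.
  - exact: red_sigma_cancel.
move=> _ [p Zp <-]; rewrite /= rmorphB/=.
rewrite Ared_sigma_rclass ?ratio_pb// ratio_sigma Ared_sigma_cst ?fixed_integral//.
exact: Zeta.
Qed.

Variables (alpha zeta : D).
Hypotheses (hzeta : zeta ^+ (q ^ 2 * (q + 1)) = 1) (hsalpha : s alpha = zeta * alpha).

Let zeta0 : zeta != 0.
Proof.
apply: contra_eqN hzeta => /eqP ->.
by rewrite expr0n muln_eq0 expn_eq0 addn1 (gtn_eqF (q_gt0 D)) eq_sym oner_eq0.
Qed.

Lemma co_y_sigma P : s (co_y alpha (pt_sigma hs P)) = zeta^-1 * co_y alpha P.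
Proof. by rewrite /co_y fmorph_div/= in_invK hsalpha invfM mulrCA. Qed.

Lemma co_x_sigma P : s (co_x alpha (pt_sigma hs P)) = zeta^-1 * co_x alpha P.
Proof. by rewrite /co_x fmorph_div/= in_invK hsalpha invfM mulrCA. Qed.

(** In characteristic p the p-part of the order of zeta is trivial. *)
Lemma zeta_order : zeta ^+ (q + 1) = 1.
Proof.
apply/eqP; rewrite -subr_eq0; have : (zeta ^+ (q + 1) - 1) ^+ (q ^ 2) == 0.
  by rewrite frobB expr1n -exprM mulnC hzeta subrr.
by rewrite expf_eq0 => /andP[].
Qed.

(** Passing from alpha to zeta * alpha divides z by zeta ^ (q * (q + 1)), which
    is 1. *)
Lemma co_z_sigma P : s (co_z alpha (pt_sigma hs P)) = co_z alpha P.
Proof.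
have zq : zeta^-1 ^+ q = zeta.
  apply: (mulIf (expf_neq0 1 (invr_neq0 zeta0))).
  by rewrite -exprD exprVn zeta_order invr1 expr1 divff.
rewrite /co_z; move: (co_x_sigma P) (co_y_sigma P).
move: (co_x _ (pt_sigma _ _)) (co_y _ (pt_sigma _ _)) => x y sx sy.
rewrite fmorph_div !(rmorphB, rmorphM, rmorphXn)/= sx sy hsalpha !exprMn zq.
have -> : zeta ^+ (q ^ 2 - 1) = 1.
  have -> : (q ^ 2 - 1 = (q + 1) * (q - 1))%N by rewrite mulnC -subn_sqr exp1n.
  by rewrite exprM zeta_order expr1n.
by rewrite mul1r; congr (_ / _); field.
Qed.

Lemma co_X_sigma : fun_sigma hs (@co_X R D pi2 alpha) = cst (zeta ^+ q) * co_X alpha.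
Proof.
apply/funext => P; rewrite /fun_sigma /co_X /co_t.
move: (co_z_sigma P) (co_y_sigma P).
move: (co_z _ (pt_sigma _ _)) (co_y _ (pt_sigma _ _)) => z y sz sy.
rewrite rmorphM rmorphN rmorphXn !div1r fmorphV sz sy invfM invrK exprMn.
by rewrite mulrCA -[_^-1]div1r.
Qed.

Lemma co_Y_sigma : fun_sigma hs (@co_Y R D pi2 alpha) = cst zeta^-1 * co_Y alpha.
Proof.
by apply/funext => P; rewrite /fun_sigma co_YE co_y_sigma -co_YE.
Qed.

End Action.

Theorem lemma4p8 (R : realType) (D : local_data R) (pi2 alpha zeta : D)
    (s : inertia D)
    (hpi2 : is_LT2_generator pi2)
    (halpha : alpha ^+ (ld_q D ^ 2 * (ld_q D + 1)) = pi2)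
    (hs : s pi2 = pi2)
    (hzeta : zeta ^+ (ld_q D ^ 2 * (ld_q D + 1)) = 1)
    (hsalpha : s alpha = zeta * alpha)
    (eta : D) (heta : eta ^+ ld_q D = eta) (heta0 : eta <> 0)
    (Z : set (spec (Ared pi2))) (hZ : is_component eta Z) :
  let q := ld_q D in
  let X : Ared pi2 := rclass (co_X alpha) in
  let Y : Ared pi2 := rclass (co_Y alpha) in
  [/\ co_X alpha \in @pb_analytic R D pi2 /\ co_Y alpha \in @pb_analytic R D pi2,
      eq_on Z (- X ^+ q * Y ^+ (q ^ 2) + X * Y ^+ (q ^ 3)) 1,
      [set red_sigma hs p | p in Z] = Z,
      eq_on Z (Ared_sigma hs X) (rclass (cst (zeta ^+ q)) * X) /\
      eq_on Z (Ared_sigma hs Y) (rclass (cst zeta^-1) * Y) &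
      forall p, Z p -> forall a b : D,
        (0 <= ld_v a)%E -> (0 <= ld_v b)%E ->
        has_coords alpha p a b ->
        has_coords alpha (red_sigma hs p) (zeta ^+ q * a) (zeta^-1 * b)].
Proof.
move=> q X Y; have vP := ld_valuation D.
have vzeta : ld_v zeta = 0%E.
  apply: (v_expr_eq0 vP (n := (q ^ 2 * (q + 1)).-1)).
  by rewrite prednK// muln_gt0 expn_gt0 q_gt0 addn1.
have vzetaX : (0 <= ld_v (zeta ^+ q)%R)%E by rewrite (vnngX vP)// vzeta.
have vzetaV : (0 <= ld_v zeta^-1)%E by rewrite (vV vP vzeta) oppr0.
have Xpb : co_X alpha \in @pb_analytic R D pi2.
  apply/asboolP; split; first exact: co_X_analytic.
  by apply/power_boundedP => P; exact: co_X_integral.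
have Ypb : co_Y alpha \in @pb_analytic R D pi2.
  have -> : co_Y alpha = co_y alpha :> (Y31c pi2 -> D).
    by apply/funext => P; exact: co_YE.
  apply/asboolP; split; first exact: co_y_analytic.
  by apply/power_boundedP => P; rewrite (co_y_val hpi2 halpha).
have XS : Ared_sigma hs X = rclass (cst (zeta ^+ q)) * X.
  by rewrite Ared_sigma_rclass// (co_X_sigma hs hzeta hsalpha) rclassM// cst_pb.
have YS : Ared_sigma hs Y = rclass (cst zeta^-1) * Y.
  by rewrite Ared_sigma_rclass// (co_Y_sigma hs hsalpha) rclassM// cst_pb.
split.
- by [].
- apply: eq_on_eq; rewrite /X /Y !rclassE -!rmorphXn -rmorphN -!rmorphM -rmorphD.
  rewrite -(rmorph1 (@redn R D pi2)).
  apply: (redn_eq_lb (val_2_gt0 D)) => P.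
  set F := MkAint Xpb; set G := MkAint Ypb.
  have -> : (- F ^+ q * G ^+ (q ^ 2) + F * G ^+ (q ^ 3)) P - (1 : Aint pi2) P =
    - (F ^+ q) P * (G ^+ (q ^ 2)) P + F P * (G ^+ (q ^ 3)) P - 1 by [].
  by rewrite !Aint_exprE; exact: co_equation.
- exact: component_sigma heta hZ.
- by split; exact: eq_on_eq.
- move=> p _ a b a0 b0 [pX pY]; split; exact: red_sigma_coord.
Qed.
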